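(* Any multi-valued function $f$ on represented spaces that is computable with finitely many mind changes or weakly computable is also low computable.
   Context: Baire space is $\mathbb{N}^{\mathbb{N}}$, with its usual product topology, a fixed computable bijective pairing $\langle\cdot,\cdot\rangle$ and the canonical countable tupling $\langle p_0,p_1,p_2,\ldots\rangle$ on it. Computability of partial functions $F:\subseteq\mathbb{N}^{\mathbb{N}}\to\mathbb{N}^{\mathbb{N}}$ is meant via (type-2) Turing machines. A representation of a set $X$ is a surjective partial function $\delta:\subseteq\mathbb{N}^{\mathbb{N}}\to X$; $(X,\delta)$ is a represented space. $f:\subseteq X\rightrightarrows Y$ denotes a partial multi-valued function. A realizer of $f:\subseteq(X,\delta_X)\rightrightarrows(Y,\delta_Y)$, written $F\vdash f$, is a single-valued $F:\subseteq\mathbb{N}^{\mathbb{N}}\to\mathbb{N}^{\mathbb{N}}$ with $\delta_Y F(p)\in f\delta_X(p)$ for all $p\in\mathrm{dom}(f\delta_X)$; $f$ is $(\delta_X,\delta_Y)$-computable if it has a computable realizer. Weihrauch reducibility $f\leq_{\mathrm W}g$ means: there are computable $K,H:\subseteq\mathbb{N}^{\mathbb{N}}\to\mathbb{N}^{\mathbb{N}}$ such that $p\mapsto K\langle p,GH(p)\rangle$ is a realizer of $f$ for every $G\vdash g$. $\{0,1\}^{\mathbb{N}}$ is represented by the restricted identity. $\mathcal{A}_-(\{0,1\}^{\mathbb{N}})$ is the set of closed subsets of Cantor space with the representation $\psi_-$ in which $p$ names $A$ iff $p$ is a (potentially empty) enumeration of words $w_i\in\{0,1\}^*$ with $A=\{0,1\}^{\mathbb{N}}\setminus\bigcup_i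 w_i\{0,1\}^{\mathbb{N}}$. Closed choice is $\mathsf{C}_{\{0,1\}^{\mathbb{N}}}:\subseteq\mathcal{A}_-(\{0,1\}^{\mathbb{N}})\rightrightarrows\{0,1\}^{\mathbb{N}},\ A\mapsto A$ with domain the non-empty closed sets (any point of $A$ is an admissible output). $f$ is weakly computable if $f\leq_{\mathrm W}\mathsf{C}_{\{0,1\}^{\mathbb{N}}}$. $f:\subseteq(X,\delta_X)\rightrightarrows(Y,\delta_Y)$ is computable with finitely many mind changes if there is a Turing machine (working on infinite sequences) that may at any stage erase its whole output tape and start writing anew, such that on each input $p\in\mathrm{dom}(f\delta_X)$ it does so only finitely many times and the infinite sequence $q$ that it finally writes satisfies $\delta_Y(q)\in f\delta_X(p)$. Let $(U_n)_{n\in\mathbb{N}}$ be a standard enumeration of the c.e. open subsets of $\mathbb{N}^{\mathbb{N}}$ (e.g. $U_n=\bigcup_{w\in W_n}w\mathbb{N}^{\mathbb{N}}$ with $W_n$ the $n$-th c.e. set of finite words over $\mathbb{N}$). The Turing jump operator $J:\mathbb{N}^{\mathbb{N}}\to\mathbb{N}^{\mathbb{N}}$ is $J(p)(n)=1$ if $p\in U_n$ and $J(p)(n)=0$ otherwise; it is injective and $J^{-1}$ denotes its partial inverse. $\lim:\subseteq\mathbb{N}^{\mathbb{N}}\to\mathbb{N}^{\mathbb{N}}$, $\langle p_0,p_1,\ldots\rangle\mapsto\lim_{i\to\infty}p_i$ (usual Baire topology). For a represented space $(X,\delta)$ the low representation is $\delta^\vee:=\delta\circ J^{-1}\circ\lim$.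 $f:\subseteq X\rightrightarrows Y$ is low computable if it is $(\delta_X,\delta_Y^\vee)$-computable. *)

(* Defs.v *)
From HB Require Import structures.
From Stdlib Require Cantor.
From mathcomp Require Import all_boot.
From mathcomp Require Import mathcomp_extra boolp classical_sets functions.
From mathcomp Require Import topology cantor.

Set Implicit Arguments.
Unset Strict Implicit.
Unset Printing Implicit Defensive.

Local Open Scope classical_set_scope.

Definition baire : Type := prod_topology (fun _ : nat => nat).

HB.instance Definition _ := Pointed.on baire.
HB.instance Definition _ := Nbhs.on baire.
HB.instance Definition _ := Topological.on baire.
HB.instance Definition _ := Uniform.on baire.

Definition cylinder (T : Type) (w : seq T) : set (nat -> T) :=
  [set x | mkseq x (size w) = w].

Lemma cylinder_mkseq (T : Type) (x y : nat -> T) (n : nat) :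
  cylinder (mkseq x n) y = (mkseq y n = mkseq x n).
Proof. by rewrite /cylinder /mkset size_mkseq. Qed.

Definition baire_pair (p q : baire) : baire :=
  fun n => if odd n then q n./2 else p n./2.

(* The i-th component of a tuple <p_0, p_1, ...>, where
   <p_0, p_1, ...>(<i, j>) = p_i(j) for the Cantor pairing on nat. *)
Definition component (p : baire) (i : nat) : baire :=
  fun j => p (Cantor.to_nat (i, j)).

Definition baire_lim (p : baire) : option baire :=
  if `[< cvg (component p @ \oo) >] then Some (lim (component p @ \oo))
  else None.

(* Type-2 Turing machines, presented as flowcharts (Post-Turing programs): a
   one-way read-only input tape, finitely many two-way work tapes (those whose
   index occurs in the program) and an output tape.  Control passes to the next
   instruction except at a successful jump; the machine halts when the program
   counter leaves the program.  The symbols on the work tapes are the finitely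
   many numbers written by the program, with 0 as the blank.
   [Erase] clears the whole output tape; ordinary machines do not use it. *)
Inductive instr : Type :=
| MoveL of nat                  (* tape *)
| MoveR of nat                  (* tape *)
| Write of nat & nat            (* tape, symbol *)
| JumpIf of nat & nat & nat     (* tape, scanned symbol, target *)
| JumpIn of bool & nat          (* scanned input bit, target *)
| Advance                       (* input head *)
| Print of bool
| Erase.

Definition program : Type := seq instr.

Definition is_erase (c : instr) : bool := if c is Erase then true else false.

(* (u, v) is the tape ... 0 0 (rev u) v 0 0 ... with the head on the first
   cell of v. *)
Definition tape : Type := (seq nat * seq nat)%type.

Definition scan (t : tape) : nat := head 0 t.2.
Definition put (a : nat) (t : tape) : tape := (t.1, a :: behead t.2).
Definition move_left (t : tape) : tape := (behead t.1, head 0 t.1 :: t.2).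
Definition move_right (t : tape) : tape := (head 0 t.2 :: t.1, behead t.2).

Record config : Type := Config {
  pc : nat;
  work : nat -> tape;
  inpos : nat;
  out : seq bool
}.

Definition init : config := Config 0 (fun _ => ([::], [::])) 0 [::].

(* Elements of Baire space are written on the input and output tapes in unary:
   n_0 n_1 ... is 1^n_0 0 1^n_1 0 ... *)
Definition unary (s : seq nat) : seq bool :=
  flatten [seq rcons (nseq n true) false | n <- s].

Definition input_bit (p : baire) (i : nat) : bool :=
  nth false (unary (mkseq p i.+1)) i.

Definition update (f : nat -> tape) (i : nat) (t : tape) : nat -> tape :=
  fun j => if j == i then t else f j.

Definition exec (p : baire) (c : instr) (s : config) : config :=
  let: Config k f i o := s in
  match c with
  | MoveL j => Config k.+1 (update f j (move_left (f j))) i o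
  | MoveR j => Config k.+1 (update f j (move_right (f j))) i o
  | Write j a => Config k.+1 (update f j (put a (f j))) i o
  | JumpIf j a l => Config (if scan (f j) == a then l else k.+1) f i o
  | JumpIn b l => Config (if input_bit p i == b then l else k.+1) f i o
  | Advance => Config k.+1 f i.+1 o
  | Print b => Config k.+1 f i (rcons o b)
  | Erase => Config k.+1 f i [::]
  end.

Definition step (M : program) (p : baire) (s : config) : config :=
  if onth M (pc s) is Some c then exec p c s else s.

Definition run (M : program) (p : baire) (t : nat) : config :=
  iter t (step M p) init.

Definition halts (M : program) (p : baire) : Prop :=
  exists t, size M <= pc (run M p t).

Definition erases_at (M : program) (p : baire) (t : nat) : bool :=
  if onth M (pc (run M p t)) is Some c then is_erase c else false.

(* From stage t0 on nothing is erased, so the output only grows and its limit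
   determines q. *)
Definition writes (M : program) (p q : baire) : Prop :=
  exists t0,
    (forall t, t0 <= t -> ~~ erases_at M p t) /\
    (forall n, exists2 t, t0 <= t &
       prefix (unary (mkseq q n)) (out (run M p t))).

(* The domain of F may be smaller than the set of inputs on which the machine
   produces an infinite output. *)
Definition computable (F : baire -> option baire) : Prop :=
  exists2 M : program, ~~ has is_erase M &
    forall p q, F p = Some q -> writes M p q.

(* Goedel numbering: every program has a number since CodeSeq.decode is a
   bijection from nat to seq nat. *)
Definition decode_instr (n : nat) : instr :=
  match CodeSeq.decode n with
  | [:: 0; i] => MoveL i
  | [:: 1; i] => MoveR i
  | [:: 2; i; a] => Write i a
  | [:: 3; i; a; l] => JumpIf i a l
  | [:: 4; b; l] => JumpIn (b != 0) l
  | [:: 5] => Advance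
  | [:: 6; b] => Print (b != 0)
  | _ => Erase
  end.

Definition decode_program (n : nat) : program :=
  map decode_instr (CodeSeq.decode n).

Definition number_input (m : nat) : baire := fun i => if i is 0 then m else 0.

Definition ce_words (n : nat) : set (seq nat) :=
  [set w | halts (decode_program n) (number_input (CodeSeq.code w))].

Definition ce_open (n : nat) : set baire :=
  \bigcup_(w in ce_words n) cylinder w.

Definition jump (p : baire) : baire := fun n => nat_of_bool `[< ce_open n p >].

Lemma decode_instr_surj (c : instr) : exists n, decode_instr n = c.
Proof.
pose w := match c with
  | MoveL i => [:: 0; i]
  | MoveR i => [:: 1; i]
  | Write i a => [:: 2; i; a]
  | JumpIf i a l => [:: 3; i; a; l]
  | JumpIn b l => [:: 4; nat_of_bool b; l]
  | Advance => [:: 5]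
  | Print b => [:: 6; nat_of_bool b]
  | Erase => [::]
  end.
exists (CodeSeq.code w); rewrite /decode_instr CodeSeq.codeK {}/w.
by case: c => // -[].
Qed.

Lemma decode_program_surj (M : program) : exists n, decode_program n = M.
Proof.
have /choice[code codeP] := decode_instr_surj.
exists (CodeSeq.code (map code M)).
by rewrite /decode_program CodeSeq.codeK mapK.
Qed.

(* A program that halts on the input m 0 0 ... for this m only. *)
Definition test_number (m : nat) : program :=
  mkseq (fun k => if k == m.*2 then JumpIn true k
                  else if odd k then Advance else JumpIn false k) m.*2.+1.

Lemma onth_mkseq (T : Type) (f : nat -> T) (n i : nat) :
  i < n -> onth (mkseq f n) i = Some (f i).
Proof.
by move=> lt_in; rewrite onthE (nth_map (f 0)) ?size_mkseq ?nth_mkseq.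
Qed.

Lemma input_bit_number (m i : nat) :
  i <= m -> input_bit (number_input m) i = (i < m).
Proof.
move=> le_im; rewrite /input_bit /mkseq /unary /= nth_cat size_rcons size_nseq.
by rewrite ltnS le_im nth_rcons size_nseq nth_nseq; case: ltngtP le_im.
Qed.

Lemma test_number_run (m m' j : nat) : j <= m -> j <= m' ->
  run (test_number m) (number_input m') j.*2 = Config j.*2 (work init) j [::].
Proof.
elim: j => // j IH lt_jm lt_jm'; rewrite /run doubleS !iterS -/(run _ _ _).
rewrite IH 1?ltnW //; set s := step _ _ (Config _ _ _ _).
have -> : s = Config j.*2.+1 (work init) j [::].
  rewrite {}/s /step [pc _]/= onth_mkseq; last by rewrite ltnS leq_double ltnW.
  rewrite -!muln2 eqn_mul2r /= ltn_eqF // muln2 odd_double /=.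
  by rewrite (input_bit_number (ltnW lt_jm')) lt_jm'.
rewrite /step [pc _]/= onth_mkseq; last by rewrite ltnS ltn_double.
by rewrite ltn_eqF ?ltn_Sdouble //= odd_double.
Qed.

Lemma test_number_halts (m m' : nat) :
  halts (test_number m) (number_input m') <-> m' = m.
Proof.
split=> [[t]|->]; last first.
  exists m.*2.+1; rewrite size_mkseq /run iterS -/(run _ _ _) test_number_run //.
  by rewrite /step [pc _]/= onth_mkseq //= eqxx /= input_bit_number // ltnn.
apply: contraPP => /eqP ne_mm'; apply/negP; rewrite -ltnNge size_mkseq ltnS.
pose j := minn m m'.
have stuck u : run (test_number m) (number_input m') (u + j.*2) =
    Config j.*2 (work init) j [::].
  elim: u => [|u IH]; first by rewrite test_number_run ?geq_minl ?geq_minr.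
  rewrite addSn /run iterS -/(run _ _ _) IH /step [pc _]/= onth_mkseq; last first.
    by rewrite ltnS leq_double geq_minl.
  rewrite -muln2 -[m.*2]muln2 eqn_mul2r /= muln2 odd_double /j.
  case: (ltngtP m m') ne_mm' => // lt_mm' _ /=.
  - by rewrite eqxx /= (input_bit_number (ltnW lt_mm')) lt_mm'.
  - by rewrite ltn_eqF //= input_bit_number // ltnn.
have [le_tj|/ltnW/subnK <-] := leqP t j.*2; last first.
  by rewrite stuck /= leq_double geq_minl.
rewrite leqNgt; apply/negP => halted.
have stay u : run (test_number m) (number_input m') (u + t) =
    run (test_number m) (number_input m') t.
  elim: u => // u IH; rewrite addSn /run iterS -/(run _ _ _) IH.
  by rewrite /step onth_default // size_mkseq.
have := stay (j.*2 - t); rewrite subnK // -[j.*2]add0n stuck => runE.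
by move: halted; rewrite -runE [pc _]/= ltn_double ltnNge geq_minl.
Qed.

Lemma jump_inj : injective jump.
Proof.
move=> p q pq; apply/funext => k; pose w := mkseq p k.+1.
have [n nP] := decode_program_surj (test_number (CodeSeq.code w)).
have wordsE v : ce_words n v <-> v = w.
  rewrite /ce_words /= nP test_number_halts.
  by split=> [/(can_inj CodeSeq.codeK)|->].
have np : ce_open n p.
  by exists w; [exact/wordsE|rewrite cylinder_mkseq].
have : ce_open n q.
  have := congr1 (@^~ n) pq; rewrite /jump asboolT //.
  by case: asboolP.
move=> [_ /wordsE ->]; rewrite cylinder_mkseq.
by move=> /(congr1 (nth 0 ^~ k)); rewrite !nth_mkseq.
Qed.

Definition jump_inv (r : baire) : option baire :=
  if `[< range jump r >] then Some (pinv setT jump r) else None.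

Record represented_space : Type := RepresentedSpace {
  carrier :> Type;
  rep : baire -> option carrier;
  rep_surj : forall x, exists p, rep p = Some x
}.

(* A partial multi-valued function from X to Y is a map X -> set Y. *)
Definition mdom (X Y : Type) (f : X -> set Y) : set X :=
  [set x | f x !=set0].

Definition realizes (X Y : represented_space) (F : baire -> option baire)
    (f : X -> set Y) : Prop :=
  forall p x, rep X p = Some x -> mdom f x ->
    exists q y, [/\ F p = Some q, rep Y q = Some y & f x y].

Definition computable_mv (X Y : represented_space) (f : X -> set Y) : Prop :=
  exists2 F, computable F & realizes F f.

Definition weihrauch_le (X Y Z W : represented_space)
    (f : X -> set Y) (g : Z -> set W) : Prop :=
  exists K H : baire -> option baire,
    [/\ computable K, computable H &
      forall G, realizes G g ->
        realizes (fun p => obind (fun q => K (baire_pair p q))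
                                 (obind G (H p))) f].

Definition mind_change_computable (X Y : represented_space)
    (f : X -> set Y) : Prop :=
  exists M : program, forall p x, rep X p = Some x -> mdom f x ->
    exists q y, [/\ writes M p q, rep Y q = Some y & f x y].

Definition cantor_rep (p : baire) : option cantor_space :=
  if `[< forall n, p n < 2 >] then Some (fun n => p n == 1) else None.

Lemma cantor_rep_surj (x : cantor_space) : exists p, cantor_rep p = Some x.
Proof.
exists (fun n => nat_of_bool (x n)); rewrite /cantor_rep asboolT; last first.
  by move=> n; case: (x n).
by congr Some; apply/funext => n; case: (x n).
Qed.

Definition cantor_repspace : represented_space :=
  RepresentedSpace cantor_rep_surj.

Definition closed_cantor : Type := {A : set cantor_space | closed A}.

(* The entry m.+1 of a name lists the binary word with code m; any other entry
   (such as 0) lists no word, so that the enumeration may be empty. *)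
Definition lists_word (p : baire) (w : seq bool) : Prop :=
  exists i, p i = (CodeSeq.code (map nat_of_bool w)).+1.

Definition negative_set (p : baire) : set cantor_space :=
  ~` \bigcup_(w in lists_word p) cylinder w.

Lemma open_cylinder (w : seq bool) : open (cylinder w : set cantor_space).
Proof.
rewrite openE => x wx; rewrite /interior.
have xP : nbhs x [set y : cantor_space | forall i : 'I_(size w), y i = x i].
  have := @filter_forall cantor_space 'I_(size w)
    (fun i => [set y | y i = x i]) (nbhs x) _; apply=> i.
  exact: (@proj_continuous nat (fun=> bool) i x [set x i] (discrete_set1 _)).
apply: filterS xP => y yx; rewrite /cylinder /= -[RHS]wx.
apply: (@eq_from_nth _ false); rewrite !size_mkseq // => i iw.
by rewrite !nth_mkseq //; exact: (yx (Ordinal iw)).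
Qed.

Lemma negative_set_closed (p : baire) : closed (negative_set p).
Proof.
by apply/open_closedC/bigcup_open => w _; exact: open_cylinder.
Qed.

Definition closed_rep (p : baire) : option closed_cantor :=
  Some (exist _ (negative_set p) (@negative_set_closed p)).

Lemma nbhs_cylinder (x : cantor_space) (U : set cantor_space) :
  nbhs x U -> exists n, cylinder (mkseq x n) `<=` U.
Proof.
move=> xU; apply: contrapT => noU.
have /choice[y yP] : forall n, exists y : cantor_space,
    cylinder (mkseq x n) y /\ ~ U y.
  move=> n; apply: contrapT => noy; apply: noU; exists n => y yn.
  by apply: contrapT => Uy; apply: noy; exists y.
suff : y @ \oo --> x by move=> /(_ _ xU)[n _ /(_ n (leqnn n))]; case: (yP n).
apply/(pointwise_cvgP (V := bool)) => i A /nbhs_singleton Axi.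
exists i.+1 => // n /= ltin; case: (yP n) => + _.
rewrite cylinder_mkseq => /(congr1 (nth false ^~ i)).
by rewrite !nth_mkseq // => ->.
Qed.

Lemma closed_rep_surj (A : closed_cantor) : exists p, closed_rep p = Some A.
Proof.
case: A => A cA.
pose P m := exists2 w : seq bool, m = (CodeSeq.code (map nat_of_bool w)).+1 &
  cylinder w `<=` ~` A.
exists (fun m => if `[< P m >] then m else 0); congr Some.
apply: eq_exist => /=; apply/seteqP; split=> x.
  move=> xp; apply: contrapT => nAx; apply: xp.
  have /nbhs_cylinder[n nA] : nbhs x (~` A).
    by apply: open_nbhs_nbhs; split=> //; exact: closed_openC.
  exists (mkseq x n); last by rewrite cylinder_mkseq.
  exists (CodeSeq.code (map nat_of_bool (mkseq x n))).+1.
  by rewrite asboolT //; exists (mkseq x n).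
move=> Ax [w [i]]; case: asboolP => // -[v -> vA] [/(can_inj CodeSeq.codeK)].
have bool_inj : injective nat_of_bool by move=> [] [].
by move=> /(inj_map bool_inj) <- /vA.
Qed.

Definition closed_repspace : represented_space :=
  RepresentedSpace closed_rep_surj.

Definition closed_choice (A : closed_repspace) : set cantor_repspace := sval A.

Definition weakly_computable (X Y : represented_space)
    (f : X -> set Y) : Prop :=
  weihrauch_le f closed_choice.

Definition low_rep (X : represented_space) (p : baire) : option X :=
  obind (rep X) (obind jump_inv (baire_lim p)).

Lemma low_rep_surj (X : represented_space) (x : X) :
  exists p, low_rep X p = Some x.
Proof.
have [q qx] := rep_surj x.
exists (fun n => jump q (Cantor.of_nat n).2); rewrite /low_rep.
have -> : baire_lim (fun n => jump q (Cantor.of_nat n).2) = Some (jump q).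
  rewrite /baire_lim.
  have -> : component (fun n => jump q (Cantor.of_nat n).2) = fun=> jump q.
    apply/funext => i; apply: funext => j.
    by rewrite /component Cantor.cancel_of_to.
  rewrite asboolT; last exact: is_cvg_cst.
  congr Some; apply: lim_cst.
  by apply: hausdorff_product => i; exact: discrete_hausdorff.
rewrite /= /jump_inv asboolT /=; last by exists q.
by rewrite pinvKV ?inE // => ? ? _ _; exact: jump_inj.
Qed.

Definition low (X : represented_space) : represented_space :=
  RepresentedSpace (@low_rep_surj X).

Definition low_computable (X Y : represented_space)
    (f : X -> set Y) : Prop :=
  @computable_mv X (low Y) f.

(* Main.v *)
Require Import Defs.
From Stdlib Require Cantor.
From mathcomp Require Import all_boot zify.
From mathcomp Require Import boolp classical_sets functions.
From mathcomp Require Import topology cantor.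

(** To compute f in the low sense, a machine must produce from a name p numbers
    b(s, n) that converge, for s to infinity, to the values J(q)(n) of the
    Turing jump of a name q of some value of f. Once b is primitive recursive in
    s, n and a prefix of p of length at least s, the rest is routine: the
    machine reads the input entry by entry and prints b(s, n) as its entry number
    <s, n> ([low_computable_stages]).

    If f is computed by a machine M with finitely many mind changes, b(s, n) says
    whether, after s steps, the output of M has a prefix that the n-th c.e. set
    is seen to contain within s steps. After the last erasure the output consists
    of prefixes of q, so that a positive answer is then correct and remains, and
    the limit is J(q)(n) ([writes_accepts]).

    If f reduces to closed choice on Cantor space, then p determines a nonempty
    closed set A, and a machine turns every point of A into a name of a value of
    f. Not every point of A has a result with a limit computable jump, but the
    low basis theorem finds one that has. Decide for n = 0, 1, 2 and so on whether
    the closed set obtained so far has a point whose result avoids the n-th c.e.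
    open set U_n, and if so, pass to the closed subset of these points. A point in
    the intersection of these sets, which exists by compactness, has a result q
    that lies in U_n if and only if the n-th decision was negative
    ([low_point]). Again by compactness, a closed set given by its complement is
    empty only if this shows at a finite stage, where only the words of a given
    length have to be inspected. The guesses made at stage s, from what is visible
    then, therefore converge to the right decisions ([guess_decisions]).

    It remains to show that machines can do all this, including the simulation of
    machines. Counters are kept on work tapes in unary notation, programs over
    them are composed from fragments with relative jumps, and registers are used
    as the variables of expressions that are closed under primitive recursion
    ([expr_rec]). The pairing 2^a (2b + 1), by which lists of numbers are coded,
    leads from there to primitive recursive functions between types of pairs and
    lists ([primrec]), among them a step by step simulation of machines
    ([primrec_simulate]). *)

Set Implicit Arguments.
Unset Strict Implicit.
Unset Printing Implicit Defensive.

Local Open Scope classical_set_scope.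

(** * Counter programs *)

(** Jump targets of a fragment are relative to its first instruction, so that
    fragments can be moved and concatenated. *)
Definition relocate (a : nat) (c : instr) : instr :=
  match c with
  | JumpIf x b l => JumpIf x b (a + l)
  | JumpIn b l => JumpIn b (a + l)
  | _ => c
  end.

Definition shift (a : nat) (c : program) : program := map (relocate a) c.

Definition hosts (M : program) (a : nat) (c : program) : Prop :=
  forall i, i < size c -> onth M (a + i) = omap (relocate a) (onth c i).

Record store : Type := Store {
  reg : nat -> nat;
  pos : nat;
  printed : seq bool
}.

Definition upd (r : nat -> nat) (x v : nat) : nat -> nat :=
  fun j => if j == x then v else r j.

Definition setr (s : store) (x v : nat) : store :=
  Store (upd (reg s) x v) (pos s) (printed s).

(** A tape whose left part is 1^n holds the counter n; whatever is under the
    head and to its right is garbage. *)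
Definition holds (s : store) (g : config) : Prop :=
  [/\ forall j, (work g j).1 = nseq (reg s j) 1,
      inpos g = pos s & out g = printed s].

Definition reaches (M : program) (p : baire) (g g' : config) : Prop :=
  exists t, iter t (step M p) g = g'.

(** Total correctness of a fragment, independently of the program around it,
    which is what lets such statements be chained. *)
Variant does (c : program) (p : baire) (s s' : store) : Prop :=
  Does of forall M a g, hosts M a c -> pc g = a -> holds s g ->
    exists2 g', reaches M p g g' & pc g' = a + size c /\ holds s' g'.

Lemma store_eq (s s' : store) : reg s =1 reg s' -> pos s = pos s' ->
  printed s = printed s' -> s = s'.
Proof. by case: s s' => [r k o] [r' k' o'] /= /funext -> -> ->. Qed.

Lemma size_shift a c : size (shift a c) = size c.
Proof. exact: size_map. Qed.

Lemma onth_shift a c i : onth (shift a c) i = omap (relocate a) (onth c i).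
Proof. by rewrite /shift onth_map. Qed.

Lemma relocateD a b c : relocate a (relocate b c) = relocate (a + b) c.
Proof. by case: c => //= *; rewrite addnA. Qed.

Lemma noerase_shift a c : has is_erase (shift a c) = has is_erase c.
Proof. by rewrite has_map; apply: eq_has; case. Qed.

Lemma onth_catl (T : Type) (s1 s2 : seq T) i :
  i < size s1 -> onth (s1 ++ s2) i = onth s1 i.
Proof. by move=> h; rewrite onth_cat h. Qed.

Lemma onth_catr (T : Type) (s1 s2 : seq T) i :
  onth (s1 ++ s2) (size s1 + i) = onth s2 i.
Proof. by rewrite onth_cat ltnNge leq_addr /= addKn. Qed.

Lemma hosts_catl M a c d : hosts M a (c ++ d) -> hosts M a c.
Proof.
by move=> h i ic; rewrite h ?size_cat ?onth_catl // (leq_trans ic) ?leq_addr.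
Qed.

Lemma hosts_catr M a b c d : b = size c ->
  hosts M a (c ++ shift b d) -> hosts M (a + b) d.
Proof.
move=> -> h i id; rewrite -addnA h; last by rewrite size_cat size_shift ltn_add2l.
rewrite onth_catr onth_shift; case: (onth d i) => //= e.
by rewrite relocateD.
Qed.

Lemma reaches_refl M p g : reaches M p g g.
Proof. by exists 0. Qed.

Lemma reaches_trans M p g g' g'' :
  reaches M p g g' -> reaches M p g' g'' -> reaches M p g g''.
Proof. by move=> [t <-] [u <-]; exists (u + t); rewrite iterD. Qed.

Lemma does_skip p s : does [::] p s s.
Proof. by split=> M a g _ ga gs; exists g; [exact: reaches_refl|rewrite addn0]. Qed.

Lemma does_seq c d p s s' s'' : does c p s s' -> does d p s' s'' ->
  does (c ++ shift (size c) d) p s s''.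
Proof.
move=> [cs] [ds]; split=> M a g hM ga gs.
have [g1 g1r [g1a g1s]] := cs M a g (hosts_catl hM) ga gs.
have [g2 g2r [g2a g2s]] := ds M _ g1 (hosts_catr erefl hM) g1a g1s.
exists g2; first exact: reaches_trans g1r g2r.
by split=> //; rewrite g2a size_cat size_shift addnA.
Qed.

Lemma step_exec M p g c : onth M (pc g) = Some c -> step M p g = exec p c g.
Proof. by rewrite /step => ->. Qed.

(** Two opposite tests of the input bit make an unconditional jump. *)
Lemma jump_back M p g l : onth M (pc g) = Some (JumpIn true l) ->
  onth M (pc g).+1 = Some (JumpIn false l) ->
  reaches M p g (Config l (work g) (inpos g) (out g)).
Proof.
move=> h1 h2; case E : (input_bit p (inpos g)).
  by exists 1; rewrite /= (step_exec p h1); case: (g) E => //= k f i o ->.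
exists 2; rewrite 2!iterS [iter 0 _ _]/= (step_exec p h1) (@step_exec _ _ _ (JumpIn false l)).
  by case: (g) E => //= k f i o ->; rewrite /= ?E.
by case: (g) E h2 => //= k f i o ->.
Qed.

(** A loop is entered at the guard [t e], which jumps to [e], just behind the
    loop, when the loop is over. *)
Definition loop (t : nat -> program) (c : program) : program :=
  t (size (t 0) + size c + 2) ++ shift (size (t 0)) c ++
  [:: JumpIn true 0; JumpIn false 0].

(** The trace of a terminating loop: [st i] is the memory before the i-th test
    and [mid i] the memory after that test. *)
Lemma does_loop t c p n (st mid : nat -> store) :
  (forall e, size (t e) = size (t 0)) ->
  (forall e i, i < n -> does (t e) p (st i) (mid i)) ->
  (forall i, i < n -> does c p (mid i) (st i.+1)) ->
  (forall e M a g, hosts M a (t e) -> pc g = a -> holds (st n) g ->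
    exists2 g', reaches M p g g' & pc g' = a + e /\ holds (st n) g') ->
  does (loop t c) p (st 0) (st n).
Proof.
move=> szt pass body exit; split=> M a g hM ga gs; set e := size (t 0) + size c + 2.
have szl : size (loop t c) = e.
  by rewrite /loop !size_cat size_shift szt /= addnA.
have hback i b : i < 2 -> onth [:: JumpIn true 0; JumpIn false 0] i = Some (JumpIn b 0) ->
    onth M (a + size (t e) + size c + i) = Some (JumpIn b a).
  move=> i2 hi; rewrite -!addnA hM; last by rewrite szl szt /e; lia.
  rewrite /loop catA addnA -[X in X + i](_ : size (t e ++ shift (size (t 0)) c) = _).
    by rewrite onth_catr hi /= addn0.
  by rewrite size_cat size_shift.
suff H k : k <= n -> forall g, pc g = a -> holds (st (n - k)) g ->
  exists2 g', reaches M p g g' & pc g' = a + size (loop t c) /\ holds (st n) g'.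
  by apply: (H n (leqnn n) g ga); rewrite subnn.
elim: k => [|k IH] kn {ga gs}g ga gs.
  by rewrite subn0 in gs; rewrite szl; apply: exit (hosts_catl hM) ga gs.
have lt : n - k.+1 < n by rewrite ltn_subrL /= (leq_trans _ kn).
have [/(_ M a g (hosts_catl hM) ga gs)[g1 r1 [g1a g1s]]] := pass e _ lt.
have [/(_ M (a + size (t e)) g1 _ g1a g1s)[]] := body _ lt.
  by move: hM; rewrite /loop catA szt => /hosts_catl h; apply: hosts_catr h; rewrite szt.
move=> g2 r2 [g2a g2s].
have r3 : reaches M p g2 (Config a (work g2) (inpos g2) (out g2)).
  apply: jump_back; rewrite g2a.
    by rewrite -[_ + size c]addn0 (hback _ true).
  by rewrite -[(_ + size c).+1]addn1 (hback _ false).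
have [|g3 r4 [g3a g3s]] := IH (ltnW kn) (Config a (work g2) (inpos g2) (out g2)) erefl.
  by rewrite subnSK // in g2s.
exists g3 => //; apply: reaches_trans r1 _; apply: reaches_trans r2 _.
exact: reaches_trans r3 r4.
Qed.

(** Moving the head of the tape x to the left pops a one off the counter x,
    and leaves zero unchanged, so that the test following it has already
    decremented. *)
Definition while (x : nat) (c : program) : program :=
  loop (fun e => [:: MoveL x; JumpIf x 0 e]) c.

Lemma pop_counter M p g a x l : hosts M a [:: MoveL x; JumpIf x 0 l] ->
  pc g = a ->
  reaches M p g (Config (if head 0 (work g x).1 == 0 then a + l else a + 2)
    (update (work g) x (move_left (work g x))) (inpos g) (out g)).
Proof.
move=> hM ga.
have m0 : onth M a = Some (MoveL x) by rewrite -[a]addn0 hM.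
have m1 : onth M a.+1 = Some (JumpIf x 0 (a + l)) by rewrite -addn1 hM.
exists 2; rewrite 2!iterS (@step_exec M p g (MoveL x)) ?ga //.
rewrite addn2 (@step_exec _ _ _ (JumpIf x 0 (a + l))).
  by case: (g) ga => /= j f i o ->; rewrite /update eqxx.
by case: (g) ga => /= j f i o ->.
Qed.

Lemma does_while x c p n (st : nat -> store) :
  (forall i, i <= n -> reg (st i) x = n - i) ->
  (forall i, i < n -> does c p (setr (st i) x (n - i).-1) (st i.+1)) ->
  does (while x c) p (st 0) (st n).
Proof.
move=> stx sti; apply: (does_loop (mid := fun i => setr (st i) x (n - i).-1)) => //.
  move=> e i lt; split=> M a g hM ga gs.
  have := pop_counter p hM ga; case: (gs) => fr gi go.
  rewrite fr stx ?(ltnW lt) //; have -> : n - i = (n - i).-1.+1 by lia.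
  move=> r; eexists; first exact: r.
  split=> //; split=> //= j; rewrite /update /upd; case: (j =P x) => [_|_ //].
  by rewrite /= fr stx ?(ltnW lt) //; have -> : n - i = (n - i).-1.+1 by lia.
move=> e M a g hM ga gs.
have := pop_counter p hM ga; case: (gs) => fr gi go.
rewrite fr stx // subnn [head _ _]/= eqxx => r; eexists; first exact: r.
split=> //; split=> //= j; rewrite /update; case: (j =P x) => [->|_ //].
by rewrite /= fr stx ?subnn.
Qed.

Definition inc (x : nat) : program := [:: Write x 1; MoveR x].

Lemma does_inc x p s : does (inc x) p s (setr s x (reg s x).+1).
Proof.
split=> M a g hM ga [fr gi go].
have m0 : onth M a = Some (Write x 1) by rewrite -[a]addn0 hM.
have m1 : onth M a.+1 = Some (MoveR x) by rewrite -addn1 hM.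
pose t := move_right (put 1 (work g x)).
exists (Config a.+2 (update (work g) x t) (inpos g) (out g)).
  exists 2; rewrite 2!iterS [iter 0 _ _]/= (@step_exec M p g (Write x 1)) ?ga //.
  rewrite (@step_exec _ _ _ (MoveR x)); last by case: (g) ga => /= j f i o ->.
  case: (g) ga @t => /= k f i o ->; rewrite /update eqxx; congr Config.
  by apply: funext => j; case: eqP.
split; first by rewrite /= addn2.
split=> //= j; rewrite /update /upd; case: (j =P x) => [_|_ //].
by rewrite /= fr.
Qed.

Lemma does_conv c p s s' s'' : does c p s s' -> s' = s'' -> does c p s s''.
Proof. by move=> h <-. Qed.

Definition cseq (c d : program) : program := c ++ shift (size c) d.

Lemma noerase_seq c d : has is_erase (cseq c d) = has is_erase c || has is_erase d.
Proof. by rewrite has_cat noerase_shift. Qed.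

Lemma noerase_while x c : has is_erase (while x c) = has is_erase c.
Proof. by rewrite /while /loop !has_cat noerase_shift /= orbF. Qed.

Lemma does_clear x p s : does (while x [::]) p s (setr s x 0).
Proof.
pose st i := setr s x (reg s x - i).
have e0 : st 0 = s by apply: store_eq => //= j; rewrite /upd subn0; case: eqP => // ->.
rewrite -{1}e0; apply: (does_conv (s' := st (reg s x))); last first.
  by rewrite /st subnn.
apply: does_while => [i _|i lt].
  by rewrite /= /upd eqxx.
apply: does_conv (does_skip _ _) _; apply: store_eq => //= j.
by rewrite /upd; case: eqP => // _; rewrite subnS.
Qed.

Lemma does_transfer x y p s : x != y ->
  does (while x (inc y)) p s (setr (setr s y (reg s y + reg s x)) x 0).
Proof.
move=> xy; pose st i := setr (setr s y (reg s y + i)) x (reg s x - i).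
have e0 : st 0 = s.
  apply: store_eq => //= j; rewrite /upd subn0 addn0.
  by case: eqP => [->|_] //; case: eqP => // ->.
rewrite -{1}e0; apply: (does_conv (s' := st (reg s x))); last first.
  by rewrite /st subnn.
apply: does_while => [i _|i lt].
  by rewrite /= /upd eqxx.
apply: does_conv (does_inc _ _ _) _; apply: store_eq => //= j.
have yx : (y == x) = false by rewrite eq_sym (negPf xy).
rewrite /upd yx eqxx; case: (j =P x) => [->|_].
  by rewrite (negPf xy) subnS.
by case: eqP => // _; rewrite addnS.
Qed.

(** A counter can only be read by emptying it; z is the spare copy from which x
    is restored. *)
Definition copy (x y z : nat) : program :=
  cseq (while x (cseq (inc y) (inc z))) (while z (inc x)).

Lemma does_copy x y z p s : x != y -> x != z -> y != z -> reg s y = 0 ->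
  reg s z = 0 -> does (copy x y z) p s (setr s y (reg s x)).
Proof.
move=> xy xz yz sy sz.
pose st i := setr (setr (setr s y i) z i) x (reg s x - i).
have ne : (y == x = false) * (z == x = false) * (z == y = false).
  by split; [split|]; rewrite eq_sym; apply: negbTE.
have ne' : (x == y = false) * (x == z = false) by split; apply: negbTE.
apply: (@does_seq _ _ _ _ (st (reg s x))).
  have e0 : st 0 = s.
    apply: store_eq => //= j; rewrite /upd subn0.
    case: (j =P x) => [->//|_]; case: (j =P z) => [->//|_].
    by case: (j =P y) => [->|].
  rewrite -{1}e0; apply: does_while => [i _|i lt].
    by rewrite /= /upd eqxx.
  apply: does_conv (does_seq (does_inc _ _ _) (does_inc _ _ _)) _.
  apply: store_eq => //= j; rewrite /upd !ne !eqxx.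
  case: (j =P x) => [->|_]; first by rewrite !ne' subnS.
  by case: (j =P z) => [//|_]; case: (j =P y) => //; rewrite (negPf yz).
apply: does_conv (does_transfer _ _ _) _; first by rewrite eq_sym.
apply: store_eq => //= j; rewrite /upd !ne !eqxx subnn add0n.
case: (j =P z) => [->|_]; first by rewrite ?ne ?sz.
by case: (j =P x) => [->|//]; rewrite (negPf xy).
Qed.

(** * Register expressions *)

Ltac decide_eqs := repeat match goal with |- context [@eq_op ?T ?a ?b] =>
  first [ rewrite (_ : @eq_op T a b = false); last (by apply/eqP; lia)
        | rewrite (_ : @eq_op T a b = true); last (by apply/eqP; lia)] end.

(** The registers below b are the variables of the expression E. Its value can
    be put into any register d above them, if the registers from d on are free;
    leaving d open lets E be evaluated after further registers have been
    filled with intermediate results. *)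
Definition expr (b : nat) (E : (nat -> nat) -> nat) : Prop :=
  (forall r r' : nat -> nat, (forall j, j < b -> r j = r' j) -> E r = E r') /\
  forall d, b <= d -> exists2 c, ~~ has is_erase c &
    forall p s, (forall j, d <= j -> reg s j = 0) ->
      does c p s (setr s d (E (reg s))).

Lemma expr_weak b b' E : b <= b' -> expr b E -> expr b' E.
Proof.
move=> bb [Eb cE]; split=> [r r' rr'|d bd]; last exact/cE/(leq_trans bb).
by apply: Eb => j jb; apply: rr'; apply: leq_trans bb.
Qed.

Lemma expr_var b i : i < b -> expr b (fun r => r i).
Proof.
move=> ib; split=> [r r' ->//|d bd]; exists (copy i d d.+1) => // p s sd.
by apply: does_copy; rewrite ?sd ?neq_ltn ?leqnSn //; rewrite ?leqnn // ?(leq_trans ib) //; lia.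
Qed.

Lemma expr_zero b : expr b (fun=> 0).
Proof.
split=> // d _; exists [::] => // p s sd.
apply: does_conv (does_skip _ _) _; apply: store_eq => //= j.
by rewrite /upd; case: eqP => // ->; rewrite sd.
Qed.

Lemma expr_succ b E : expr b E -> expr b (fun r => (E r).+1).
Proof.
move=> [Eb cE]; split=> [r r' /Eb ->//|d bd]; have [c c0 cP] := cE d bd.
exists (cseq c (inc d)); first by rewrite noerase_seq negb_or c0.
move=> p s sd; apply: does_conv (does_seq (cP _ _ sd) (does_inc _ _ _)) _.
by apply: store_eq => //= j; rewrite /upd eqxx; case: eqP.
Qed.

(** Primitive recursion. The registers d, d+1, d+2, d+3 hold the accumulator,
    the index of the round, the number of rounds that remain, and the next value
    of the accumulator. *)
Lemma expr_rec b N z (B : (nat -> nat) -> nat -> nat -> nat) :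
  expr b N -> expr b z ->
  (forall r r' : nat -> nat, (forall j, j < b -> r j = r' j) -> B r = B r') ->
  (forall d, b <= d -> expr d.+2 (fun r => B r (r d.+1) (r d))) ->
  expr b (fun r => nat_rec (fun=> nat) (z r) (B r) (N r)).
Proof.
move=> [Nb cN] [zb cz] Bb cB; split=> [r r' rr'|d bd].
  by rewrite (Nb _ _ rr') (zb _ _ rr') (Bb _ _ rr').
have [c1 c1n c1P] := cz d bd.
have [c2 c2n c2P] := cN d.+2 (leq_trans bd (ltnW (leqnSn _))).
have [c3 c3n c3P] := (cB d bd).2 d.+3 (leqnSn _).
exists (cseq (cseq c1 c2) (cseq (while d.+2
  (cseq (cseq c3 (while d [::])) (cseq (while d.+3 (inc d)) (inc d.+1))))
  (while d.+1 [::]))).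
  by rewrite !(noerase_seq, noerase_while) !negb_or c1n c2n c3n.
move=> p s sd.
pose n := N (reg s).
pose f := nat_rec (fun=> nat) (z (reg s)) (B (reg s)).
pose st i := setr (setr (setr s d (f i)) d.+1 i) d.+2 (n - i).
have agree (r r' : nat -> nat) : (forall j, j < d -> r j = r' j) ->
  forall j, j < b -> r j = r' j by move=> h j jb; apply: h; apply: leq_trans bd.
have s0 : does (cseq c1 c2) p s (st 0).
  apply: does_conv (does_seq (c1P _ _ sd) (c2P _ _ _)) _.
    by move=> j dj; rewrite /= /upd gtn_eqF ?sd //; lia.
  apply: store_eq => //= j.
  rewrite /upd subn0 (Nb _ (reg s)); last first.
    by move=> i ib; rewrite ltn_eqF // (leq_trans ib).
  have [//|_] := eqVneq j d.+2; have [->|//] := eqVneq j d.+1.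
  by rewrite gtn_eqF ?sd.
apply: does_seq s0 _; apply: (@does_seq _ _ _ _ (st n)); last first.
  apply: does_conv (does_clear _ _ _) _; apply: store_eq => //= j.
  rewrite /upd subnn; case: eqP => [->|_]; first by rewrite gtn_eqF ?sd.
  by case: eqP => [->|//]; rewrite gtn_eqF ?sd //; lia.
apply: does_while => [i _|i lt]; first by rewrite /= /upd eqxx.
apply: does_conv (does_seq (does_seq (c3P _ _ _) (does_clear _ _ _))
  (does_seq (does_transfer _ _ _) (does_inc _ _ _))) _.
- by move=> j dj; rewrite /= /upd !gtn_eqF ?sd //; lia.
- by apply/eqP; lia.
apply: store_eq => //= j; rewrite (_ : B _ _ _ = f i.+1); last first.
  rewrite /upd !eqxx !ltn_eqF //= (Bb _ (reg s)) //.
  by move=> k kb; rewrite !ltn_eqF //; lia.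
rewrite /upd !eqxx.
have [->|/eqP jd3] := eqVneq j d.+3; first by decide_eqs; rewrite sd; lia.
have [->|/eqP jd] := eqVneq j d; first by decide_eqs.
have [->|/eqP jd1] := eqVneq j d.+1; first by decide_eqs.
by have [_|/eqP jd2] := eqVneq j d.+2; decide_eqs; rewrite ?subnS.
Qed.

(** * Pairing *)

Lemma expr_iter b N z (B : (nat -> nat) -> nat -> nat) :
  expr b N -> expr b z ->
  (forall r r' : nat -> nat, (forall j, j < b -> r j = r' j) -> B r = B r') ->
  (forall d, b <= d -> expr d.+2 (fun r => B r (r d))) ->
  expr b (fun r => iter (N r) (B r) (z r)).
Proof.
move=> hN hz Bb hB.
have -> : (fun r => iter (N r) (B r) (z r)) =
    fun r => nat_rec (fun=> nat) (z r) (fun=> B r) (N r).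
  by apply: funext => r; elim: (N r) => //= n ->.
by apply: expr_rec => // r r' /Bb ->.
Qed.

Lemma expr_not b E : expr b E -> expr b (fun r => nat_of_bool (E r == 0)).
Proof.
move=> hE; have -> : (fun r => nat_of_bool (E r == 0)) =
    fun r => iter (E r) (fun=> 0) 1.
  by apply: funext => r; case: (E r).
apply: expr_iter => //; first exact/expr_succ/expr_zero.
by move=> d bd; exact: expr_zero.
Qed.

Lemma expr_odd b E : expr b E -> expr b (fun r => nat_of_bool (odd (E r))).
Proof.
move=> hE; have -> : (fun r => nat_of_bool (odd (E r))) =
    fun r => iter (E r) (fun a => nat_of_bool (a == 0)) 0.
  by apply: funext => r; elim: (E r) => //= n <-; case: odd.
apply: expr_iter => //; first exact/expr_zero.
by move=> d bd; apply/expr_not/expr_var.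
Qed.

Lemma expr_add b E F : expr b E -> expr b F -> expr b (fun r => E r + F r).
Proof.
move=> hE hF; have -> : (fun r => E r + F r) = fun r => iter (E r) succn (F r).
  by apply: funext => r; rewrite iter_succn addnC.
apply: expr_iter => // d bd.
by apply/expr_succ/expr_var.
Qed.

Lemma expr_half b E : expr b E -> expr b (fun r => (E r)./2).
Proof.
move=> hE; have -> : (fun r => (E r)./2) =
    fun r => nat_rec (fun=> nat) 0 (fun i a => nat_of_bool (odd i) + a) (E r).
  by apply: funext => r; elim: (E r) => //= n <-; rewrite uphalf_half.
apply: expr_rec => // [|d bd]; first exact/expr_zero.
by apply/expr_add; [apply/expr_odd|]; apply/expr_var.
Qed.

(** The pairing underlying CodeSeq.code, for which a list of numbers and its
    code can be identified. *)
Definition npair (a b : nat) : nat := 2 ^ a * b.*2.+1.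

(** The number of times that n can be halved; n rounds are enough. *)
Definition nfst (n : nat) : nat := iter n (fun a => if odd (iter a half n) then a else a.+1) 0.
Definition nsnd (n : nat) : nat := iter (nfst n).+1 half n.

Lemma iter_half_npair k a b : k <= a -> iter k half (npair a b) = npair (a - k) b.
Proof.
elim: k => [|k IH] ka; first by rewrite subn0.
rewrite iterS IH 1?ltnW // /npair -subnSK // expnS -mulnA mul2n doubleK.
by [].
Qed.

Lemma nfstE a b : nfst (npair a b) = a.
Proof.
rewrite /nfst; set f := fun _ => _.
suff H k : iter k f 0 = minn k a.
  rewrite H; apply/minn_idPr/(leq_trans (ltnW (ltn_expl a (ltnSn 1)))).
  by rewrite leq_pmulr.
elim: k => [|k IH]; first by rewrite min0n.
rewrite iterS IH /f iter_half_npair ?geq_minr // /npair oddM oddX /= odd_double.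
rewrite orbF andbT; have [ka|] := ltnP k a; last move=> ak.
  by rewrite (minn_idPl ka) subn_eq0 leqNgt ka.
by rewrite (minn_idPr (leqW ak)) subnn.
Qed.

Lemma nsndE a b : nsnd (npair a b) = b.
Proof.
rewrite /nsnd nfstE iterS iter_half_npair // subnn /npair mul1n.
by rewrite -[_.+1]add1n halfD odd_double /= doubleK.
Qed.

Lemma npair_gt0 a b : 0 < npair a b.
Proof. by rewrite muln_gt0 expn_gt0. Qed.

Lemma expr_double b E : expr b E -> expr b (fun r => (E r).*2).
Proof.
move=> h; have -> : (fun r => (E r).*2) = fun r => E r + E r.
  by apply: funext => r; rewrite addnn.
exact: expr_add.
Qed.

Lemma expr_pair b E F : expr b E -> expr b F -> expr b (fun r => npair (E r) (F r)).
Proof.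
move=> hE hF; have -> : (fun r => npair (E r) (F r)) =
    fun r => iter (E r) double (F r).*2.+1.
  apply: funext => r; rewrite /npair; elim: (E r) => [|n IH]; first exact: mul1n.
  by rewrite expnS -mulnA IH mul2n.
apply: expr_iter => // [|d bd]; first exact/expr_succ/expr_double.
exact/expr_double/expr_var.
Qed.

Lemma expr_half_iter b E F : expr b E -> expr b F ->
  expr b (fun r => iter (E r) half (F r)).
Proof.
by move=> hE hF; apply: expr_iter => // d bd; exact/expr_half/expr_var.
Qed.

Lemma expr_fst b E : expr b E -> expr b (fun r => nfst (E r)).
Proof.
move=> hE; apply: (expr_iter (B := fun r a => if odd (iter a half (E r)) then a else a.+1)) => //.
- exact: expr_zero.
- by move=> r r' /hE.1 ->.
move=> d bd.
have -> : (fun r => if odd (iter (r d) half (E r)) then r d else (r d).+1) =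
    fun r => (odd (iter (r d) half (E r)) == 0 :> nat) + r d.
  by apply: funext => r; case: odd.
by apply/expr_add; [apply/expr_not/expr_odd/expr_half_iter|];
  [exact/expr_var|apply: expr_weak hE; lia|exact/expr_var].
Qed.

Lemma expr_snd b E : expr b E -> expr b (fun r => nsnd (E r)).
Proof.
by move=> hE; apply: expr_half_iter => //; exact/expr_succ/expr_fst.
Qed.

(** * Compilable functions of one number *)

(** Formulated as closure of expressions under f, which makes composition
    immediate and dispenses with a calling convention. *)
Definition compilable (f : nat -> nat) : Prop :=
  forall b E, expr b E -> expr b (fun r => f (E r)).

(** The parameter x stays available in the body because it is paired with the
    accumulator. *)
Lemma compilable_iter N z B : compilable N -> compilable z -> compilable B ->
  compilable (fun x => iter (N x) (fun a => B (npair x a)) (z x)).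
Proof.
move=> hN hz hB b E hE; apply: expr_iter; [exact: hN|exact: hz| |].
  by move=> r r' /hE.1 ->.
move=> d bd; apply/hB/expr_pair; last exact/expr_var.
by apply: expr_weak hE; lia.
Qed.

(** * Transforming the input number by number *)

Lemma does_print b p s : does [:: Print b] p s (Store (reg s) (pos s) (rcons (printed s) b)).
Proof.
split=> M a g hM ga [fr gi go].
have m0 : onth M (pc g) = Some (Print b) by rewrite ga -[a]addn0 hM.
exists (Config a.+1 (work g) (inpos g) (rcons (out g) b)).
  by exists 1; rewrite /= (step_exec p m0); case: (g) ga => /= k f i o ->.
by split; [rewrite /= addn1|split=> //=; rewrite go].
Qed.

Lemma does_advance p s : does [:: Advance] p s (Store (reg s) (pos s).+1 (printed s)).
Proof.
split=> M a g hM ga [fr gi go].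
have m0 : onth M (pc g) = Some Advance by rewrite ga -[a]addn0 hM.
exists (Config a.+1 (work g) (inpos g).+1 (out g)).
  by exists 1; rewrite /= (step_exec p m0); case: (g) ga => /= k f i o ->.
by split; [rewrite /= addn1|split=> //=; rewrite gi].
Qed.

Definition read (x : nat) : program :=
  cseq (loop (fun e => [:: JumpIn false e]) (cseq (inc x) [:: Advance])) [:: Advance].

Lemma unary_cat s s' : unary (s ++ s') = unary s ++ unary s'.
Proof. by rewrite /unary map_cat flatten_cat. Qed.

Lemma size_unary s : size s <= size (unary s).
Proof. by elim: s => //= n s IH; rewrite size_cat size_rcons ltnS (leq_trans IH) ?leq_addl. Qed.

Lemma mkseq_cat (T : Type) (f : nat -> T) n k :
  mkseq f (n + k) = mkseq f n ++ mkseq (fun i => f (n + i)) k.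
Proof.
rewrite /mkseq iotaD map_cat add0n; congr cat.
by rewrite -[n in iota n]addn0 iotaDl -map_comp.
Qed.

Lemma unary_mkseqS p n : unary (mkseq p n.+1) =
  unary (mkseq p n) ++ rcons (nseq (p n) true) false.
Proof. by rewrite -addn1 mkseq_cat unary_cat /unary /= cats0 addn0. Qed.

Lemma input_bitE p n i : i < n -> input_bit p i = nth false (unary (mkseq p n)) i.
Proof.
move=> ilt; rewrite /input_bit -[n in RHS](subnKC ilt) mkseq_cat unary_cat nth_cat.
by rewrite (leq_trans _ (size_unary _)) // size_mkseq.
Qed.

(** The input head, having passed n entries, scans the unary notation of the
    next one. *)
Lemma input_bit_unary p n i : i <= p n ->
  input_bit p (size (unary (mkseq p n)) + i) = (i < p n).
Proof.
move=> le; set k := size _.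
have nk : n <= k by rewrite /k (leq_trans _ (size_unary _)) // size_mkseq.
rewrite (@input_bitE p (n.+1 + (k + i))); last by lia.
rewrite mkseq_cat unary_cat unary_mkseqS -catA nth_cat -/k ltnNge leq_addr /= addKn.
rewrite nth_cat size_rcons size_nseq ltnS le nth_rcons size_nseq nth_nseq.
by case: ltngtP le.
Qed.

Lemma does_read x p s k : pos s = size (unary (mkseq p k)) ->
  does (read x) p s (Store (upd (reg s) x (reg s x + p k))
    (size (unary (mkseq p k.+1))) (printed s)).
Proof.
move=> sk.
pose st i := Store (upd (reg s) x (reg s x + i)) (pos s + i) (printed s).
have e0 : st 0 = s.
  apply: store_eq => //=; last exact: addn0.
  by move=> j; rewrite /upd addn0; case: eqP => // ->.
apply: (does_conv (s' := Store (reg (st (p k))) (pos (st (p k))).+1 (printed s))); last first.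
  apply: store_eq => //=; rewrite unary_mkseqS size_cat size_rcons size_nseq sk.
  by rewrite addnS.
apply: does_seq (does_advance p (st (p k))).
rewrite -{1}e0; apply: (does_loop (mid := st)) => //.
- move=> e i lt; split=> M a g hM ga gs.
  have m0 : onth M (pc g) = Some (JumpIn false (a + e)) by rewrite ga -[a in onth _ a]addn0 hM.
  exists (Config a.+1 (work g) (inpos g) (out g)).
    exists 1; rewrite /= (step_exec p m0); case: gs => _ + _.
    case: (g) ga => /= j f o l -> ->.
    by rewrite sk input_bit_unary ?(ltnW lt) // lt.
  by rewrite addn1.
- move=> i lt; apply: does_conv (does_seq (does_inc _ _ _) (does_advance _ _)) _.
  apply: store_eq => //=; last by rewrite addnS.
  by move=> j; rewrite /upd eqxx; case: eqP => // _; rewrite addnS.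
move=> e M a g hM ga gs.
have m0 : onth M (pc g) = Some (JumpIn false (a + e)) by rewrite ga -[a in onth _ a]addn0 hM.
exists (Config (a + e) (work g) (inpos g) (out g)) => //.
exists 1; rewrite /= (step_exec p m0); case: gs => _ + _.
case: (g) ga => /= j f o l -> ->.
by rewrite sk input_bit_unary // ltnn.
Qed.

Definition print (x : nat) : program :=
  cseq (while x [:: Print true]) [:: Print false].

Lemma does_print_num x p s : does (print x) p s
  (Store (upd (reg s) x 0) (pos s) (printed s ++ rcons (nseq (reg s x) true) false)).
Proof.
pose st i := Store (upd (reg s) x (reg s x - i)) (pos s) (printed s ++ nseq i true).
have e0 : st 0 = s.
  apply: store_eq => //=; last exact: cats0.
  by move=> j; rewrite /upd subn0; case: eqP => // ->.
apply: does_conv (does_seq (s' := st (reg s x)) _ (does_print _ _ _)) _; last first.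
  by apply: store_eq => //=; rewrite ?subnn // rcons_cat.
rewrite -{1}e0; apply: does_while => [i _|i lt]; first by rewrite /= /upd eqxx.
apply: does_conv (does_print _ _ _) _; apply: store_eq => //=.
  by move=> j; rewrite /upd; case: eqP => // _; rewrite subnS.
rewrite rcons_cat; congr (_ ++ _).
by rewrite -cats1 -[[:: true]]/(nseq 1 true) -nseqD addn1.
Qed.

Lemma noerase_erases_at M p t : ~~ has is_erase M -> ~~ erases_at M p t.
Proof.
rewrite /erases_at; elim: M (pc _) => [|c M IH] [|k] //=; rewrite negb_or => /andP[// _].
exact: IH.
Qed.

(** The machine keeps the prefix read so far in one counter, as the code of the
    reversed list, to which a new entry is added by a single pairing. *)
Lemma stagewise_computable (f : nat -> nat) : compilable f ->
  computable (fun p => Some (fun k => f (CodeSeq.code (rev (mkseq p k.+1))))).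
Proof.
move=> hf.
have [cp cpn cpP] := (expr_pair (@expr_var 2 1 isT) (@expr_var 2 0 isT)).2 2 (leqnn 2).
have [cf cfn cfP] := (hf 1 _ (@expr_var 1 0 isT)).2 1 (leqnn 1).
(* Register 0 holds the code of the prefix, register 1 the new entry and later
   the number to be printed, register 2 the code of the longer prefix. *)
pose body := cseq (cseq (read 1) cp) (cseq (cseq (while 0 [::]) (while 1 [::]))
  (cseq (while 2 (inc 0)) (cseq cf (print 1)))).
pose M := body ++ [:: JumpIn true 0; JumpIn false 0].
have noM : ~~ has is_erase M.
  rewrite /M /body has_cat !(noerase_seq, noerase_while) /= !negb_or cpn.
  by rewrite cfn.
exists M => // p q [<-] {q}; set q := fun k => _.
pose st k := Store (upd (fun=> 0) 0 (CodeSeq.code (rev (mkseq p k))))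
  (size (unary (mkseq p k))) (unary (mkseq q k)).
have bodyP k : does body p (st k) (st k.+1).
  apply: does_conv (does_seq (does_seq (@does_read 1 p (st k) k erefl) (cpP _ _ _))
    (does_seq (does_seq (does_clear _ _ _) (does_clear _ _ _))
    (does_seq (does_transfer _ _ _) (does_seq (cfP _ _ _) (does_print_num _ _ _))))) _ => //.
  - by case=> [|[|j]].
  - by case=> [|[|[|j]]].
  have eN : CodeSeq.code (rev (mkseq p k.+1)) =
      npair (p k) (CodeSeq.code (rev (mkseq p k))).
    by rewrite mkseqS rev_rcons.
  apply: store_eq => //= [[|[|[|j]]]|] //=.
  by rewrite unary_mkseqS /= -eN.
have hM : hosts M 0 body by move=> i ib; rewrite add0n /M onth_catl //; case: onth => // -[].
have stP k : exists2 g, reaches M p init g & pc g = 0 /\ holds (st k) g.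
  elim: k => [|k [g r [ga gs]]].
    exists init; first exact: reaches_refl.
    by split=> //; split=> //= -[].
  have [/(_ M 0 g hM ga gs)[g1 r1 [g1a g1s]]] := bodyP k.
  exists (Config 0 (work g1) (inpos g1) (out g1)) => //.
  apply: reaches_trans r _; apply: reaches_trans r1 _; apply: jump_back; rewrite g1a add0n.
    by rewrite /M -[size body]addn0 onth_catr.
  by rewrite /M -addn1 onth_catr.
exists 0; split.
  by move=> t _; apply: noerase_erases_at; apply: noM.
move=> n; have [g [t <-] [_ [_ _ /= gn]]] := stP n.
by exists t => //; rewrite /run gn prefix_refl.
Qed.

(** * Primitive recursive functions between coded types *)

(** Functions are represented by what they do on codes, so that a coding is
    just a map to the numbers. *)
Class Coded (A : Type) : Type := enc : A -> nat.

#[export] Instance coded_nat : Coded nat := id.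
#[export] Instance coded_bool : Coded bool := nat_of_bool.
#[export] Instance coded_prod A B {cA : Coded A} {cB : Coded B} : Coded (A * B) :=
  fun x => npair (enc x.1) (enc x.2).
#[export] Instance coded_seq A {cA : Coded A} : Coded (seq A) :=
  foldr (fun a n => npair (enc a) n) 0.

(** The functions obtained from the basic ones by composition and iteration,
    represented on codes. *)
Definition primrec A B {cA : Coded A} {cB : Coded B} (f : A -> B) : Prop :=
  exists2 phi, compilable phi & forall a, phi (enc a) = enc (f a).

Lemma compilable_const n : compilable (fun=> n).
Proof. by move=> b E _; elim: n => [|n]; [exact: expr_zero|exact: expr_succ]. Qed.

Section Pr.
Context {G : Type} {cG : Coded G}.

Lemma primrec_id : primrec (fun x : G => x).
Proof. by exists id. Qed.

Lemma primrec_const A {cA : Coded A} (a : A) : primrec (fun _ : G => a).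
Proof. by exists (fun=> enc a) => //; exact: compilable_const. Qed.

Lemma primrec_comp A B {cA : Coded A} {cB : Coded B} (f : A -> B) (g : G -> A) :
  primrec f -> primrec g -> primrec (fun x => f (g x)).
Proof.
move=> [phi hphi fE] [psi hpsi gE]; exists (fun n => phi (psi n)).
  by move=> b E hE; apply/hphi/hpsi.
by move=> a; rewrite gE fE.
Qed.

Lemma primrec_pair A B {cA : Coded A} {cB : Coded B} (f : G -> A) (g : G -> B) :
  primrec f -> primrec g -> primrec (fun x => (f x, g x)).
Proof.
move=> [phi hphi fE] [psi hpsi gE]; exists (fun n => npair (phi n) (psi n)).
  by move=> b E hE; apply/expr_pair; [apply/hphi|apply/hpsi].
by move=> a; rewrite gE fE.
Qed.

Lemma primrec_fst A B {cA : Coded A} {cB : Coded B} (f : G -> A * B) :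
  primrec f -> primrec (fun x => (f x).1).
Proof.
apply: (@primrec_comp _ _ _ _ fst); exists nfst; last by move=> a; rewrite nfstE.
by move=> b E hE; apply/expr_fst.
Qed.

Lemma primrec_snd A B {cA : Coded A} {cB : Coded B} (f : G -> A * B) :
  primrec f -> primrec (fun x => (f x).2).
Proof.
apply: (@primrec_comp _ _ _ _ snd); exists nsnd; last by move=> a; rewrite nsndE.
by move=> b E hE; apply/expr_snd.
Qed.

Lemma primrec_succ (f : G -> nat) : primrec f -> primrec (fun x => (f x).+1).
Proof.
by apply: (@primrec_comp _ _ _ _ succn); exists succn => // b E hE; apply/expr_succ.
Qed.

Lemma primrec_cons A {cA : Coded A} (a : G -> A) (s : G -> seq A) :
  primrec a -> primrec s -> primrec (fun x => a x :: s x).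
Proof.
move=> [phi hphi fE] [psi hpsi gE]; exists (fun n => npair (phi n) (psi n)).
  by move=> b E hE; apply/expr_pair; [apply/hphi|apply/hpsi].
by move=> x; rewrite gE fE.
Qed.

Lemma primrec_iter A {cA : Coded A} (n : G -> nat) (z : G -> A) (f : G -> A -> A) :
  primrec n -> primrec z -> primrec (fun x : G * A => f x.1 x.2) ->
  primrec (fun x => iter (n x) (f x) (z x)).
Proof.
move=> [phi hphi nE] [psi hpsi zE] [chi hchi fE].
exists (fun x => iter (phi x) (fun a => chi (npair x a)) (psi x)).
  exact: compilable_iter.
move=> x; rewrite nE zE -[enc (n x)]/(n x); elim: (n x) => //= m ->.
exact: (fE (x, _)).
Qed.

(** Branching is iteration of a constant function zero times or once. *)
Lemma primrec_if A {cA : Coded A} (b : G -> bool) (f g : G -> A) :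
  primrec b -> primrec f -> primrec g -> primrec (fun x => if b x then f x else g x).
Proof.
move=> [beta hb bE] [phi hphi fE] [psi hpsi gE].
exists (fun x => iter (beta x) (fun a => phi (nfst (npair x a))) (psi x)).
  apply: (@compilable_iter beta psi (fun y => phi (nfst y))) => // c E hE.
  by apply/hphi/expr_fst.
by move=> x; rewrite bE; case: (b x) => //=; rewrite nfstE.
Qed.

(** The code of a nonempty list is that of the pair of its head and tail, so
    that matching on a list amounts to a test for zero. *)
Lemma primrec_case A B {cA : Coded A} {cB : Coded B} (s : G -> seq A) (f : G -> B)
    (g : G -> A -> seq A -> B) :
  primrec s -> primrec f -> primrec (fun x : G * (A * seq A) => g x.1 x.2.1 x.2.2) ->
  primrec (fun x => if s x is a :: s' then g x a s' else f x).
Proof.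
move=> [sigma hs sE] [phi hphi fE] [psi hpsi gE].
exists (fun x => iter (sigma x) (fun _ => psi (npair x (sigma x))) (phi x)).
  pose B' y := psi (npair (nfst y) (sigma (nfst y))).
  have -> : (fun x => iter (sigma x) (fun _ => psi (npair x (sigma x))) (phi x)) =
      fun x => iter (sigma x) (fun a => B' (npair x a)) (phi x).
    apply: funext => x; rewrite /B'.
    by elim: {1 3}(sigma x) => //= n _; rewrite nfstE.
  apply: (@compilable_iter sigma phi B') => // c E hE.
  by apply/hpsi/expr_pair; [|apply/hs]; exact/expr_fst.
move=> x; rewrite sE; case: (s x) => [|a s']; first exact: fE.
transitivity (psi (enc (x, (a, s')))); last exact: gE.
have : 0 < enc (a :: s') by exact: npair_gt0.
by change (enc (x, (a, s'))) with (npair (enc x) (enc (a :: s'))); case: (enc (a :: s')).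
Qed.

Lemma primrec_pred (f : G -> nat) : primrec f -> primrec (fun x => (f x).-1).
Proof.
apply: (@primrec_comp _ _ _ _ predn); exists predn => // b E hE.
have -> : (fun r => (E r).-1) =
    fun r => nat_rec (fun=> nat) 0 (fun i a => i) (E r).
  by apply: funext => r; case: (E r).
apply: expr_rec => // [|d bd]; first exact: expr_zero.
exact: expr_var.
Qed.

End Pr.

Section Arith.
Context {G : Type} {cG : Coded G}.

Lemma primrec_subn (m n : G -> nat) :
  primrec m -> primrec n -> primrec (fun x => m x - n x).
Proof.
move=> hm hn; have -> : (fun x => m x - n x) = fun x => iter (n x) predn (m x).
  apply: funext => x; elim: (n x) => [|k IH]; first exact: subn0.
  by rewrite subnS IH.
by apply: primrec_iter => //; apply/primrec_pred/primrec_snd/primrec_id.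
Qed.

Lemma primrec_addn (m n : G -> nat) :
  primrec m -> primrec n -> primrec (fun x => m x + n x).
Proof.
move=> hm hn; have -> : (fun x => m x + n x) = fun x => iter (n x) succn (m x).
  by apply: funext => x; rewrite iter_succn addnC.
by apply: primrec_iter => //; apply/primrec_succ/primrec_snd/primrec_id.
Qed.

Lemma primrec_negb (b : G -> bool) : primrec b -> primrec (fun x => ~~ b x).
Proof. by move=> hb; apply: primrec_if => //; apply: primrec_const. Qed.

Lemma primrec_andb (b c : G -> bool) :
  primrec b -> primrec c -> primrec (fun x => b x && c x).
Proof. by move=> hb hc; apply: primrec_if => //; apply: primrec_const. Qed.

Lemma primrec_orb (b c : G -> bool) :
  primrec b -> primrec c -> primrec (fun x => b x || c x).
Proof. by move=> hb hc; apply: (@primrec_if _ _ _ _ b (fun=> true)) => //; apply: primrec_const. Qed.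

Lemma primrec_eq0 (n : G -> nat) : primrec n -> primrec (fun x => n x == 0).
Proof.
move=> hn; have -> : (fun x => n x == 0) = fun x => iter (n x) (fun=> false) true.
  by apply: funext => x; case: (n x).
by apply: primrec_iter => //; apply: primrec_const.
Qed.

Lemma primrec_leq (m n : G -> nat) :
  primrec m -> primrec n -> primrec (fun x => m x <= n x).
Proof. by move=> hm hn; apply/primrec_eq0/primrec_subn. Qed.

Lemma primrec_eqn (m n : G -> nat) :
  primrec m -> primrec n -> primrec (fun x => m x == n x).
Proof.
move=> hm hn; have -> : (fun x => m x == n x) = fun x => (m x <= n x) && (n x <= m x).
  by apply: funext => x; rewrite eqn_leq.
by apply: primrec_andb; apply: primrec_leq.
Qed.

Lemma primrec_eqb (b c : G -> bool) :
  primrec b -> primrec c -> primrec (fun x => b x == c x).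
Proof.
move=> hb hc; have -> : (fun x => b x == c x) = fun x => if b x then c x else ~~ c x.
  by apply: funext => x; case: (b x); case: (c x).
by apply: primrec_if => //; apply: primrec_negb.
Qed.

Lemma primrec_code (s : G -> seq nat) :
  primrec s -> primrec (fun x => CodeSeq.code (s x)).
Proof. by move=> [phi hphi sE]; exists phi. Qed.

Lemma primrec_decode (n : G -> nat) :
  primrec n -> primrec (fun x => CodeSeq.decode (n x)).
Proof.
by move=> [phi hphi nE]; exists phi => // a; rewrite nE -[n a in LHS]CodeSeq.decodeK.
Qed.

End Arith.

Ltac primrec_basic := cbv beta; lazymatch goal with
  | |- primrec (fun x => x) => exact: primrec_id
  | |- primrec (fun _ => ?c) => exact: (primrec_const c)
  | |- primrec (fun _ => (_, _)) => apply: primrec_pair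
  | |- primrec (@fst _ _) => exact: (primrec_fst primrec_id)
  | |- primrec (@snd _ _) => exact: (primrec_snd primrec_id)
  | |- primrec (fun _ => fst _) => apply: primrec_fst
  | |- primrec (fun _ => snd _) => apply: primrec_snd
  | |- primrec (fun _ => _ :: _) => apply: primrec_cons
  | |- primrec (fun _ => if _ then _ else _) => apply: primrec_if
  | |- primrec (fun _ => _.+1) => apply: primrec_succ
  | |- primrec (fun _ => _.-1) => apply: primrec_pred
  | |- primrec (fun _ => _ - _) => apply: primrec_subn
  | |- primrec (fun _ => _ + _) => apply: primrec_addn
  | |- primrec (fun _ => ~~ _) => apply: primrec_negb
  | |- primrec (fun _ => _ && _) => apply: primrec_andb
  | |- primrec (fun _ => _ || _) => apply: primrec_orb
  | |- primrec (fun _ => _ <= _) => apply: primrec_leq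
  | |- primrec (fun _ => _ == _) => first [apply: primrec_eqn | apply: primrec_eqb]
  | |- primrec (fun _ => CodeSeq.code _) => apply: primrec_code
  | |- primrec (fun _ => CodeSeq.decode _) => apply: primrec_decode
  end.

Section Lists.
Context {G : Type} {cG : Coded G}.

(** A list is consumed by iteration; its code bounds its length. *)
Lemma primrec_foldl A B {cA : Coded A} {cB : Coded B} (f : G -> B -> A -> B)
    (z : G -> B) (s : G -> seq A) :
  primrec (fun x : G * (B * A) => f x.1 x.2.1 x.2.2) -> primrec z -> primrec s ->
  primrec (fun x => foldl (f x) (z x) (s x)).
Proof.
move=> hf hz hs.
pose next x (y : B * seq A) := if y.2 is a :: s' then (f x y.1 a, s') else y.
have -> : (fun x => foldl (f x) (z x) (s x)) =
    fun x => (iter (enc (s x)) (next x) (z x, s x)).1.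
  apply: funext => x.
  have : size (s x) <= enc (s x).
    elim: (s x) => //= a s' IH; apply: leq_ltn_trans IH _.
    apply: leq_trans (_ : (enc s').*2.+1 <= _); first by rewrite ltnS -addnn leq_addr.
    by rewrite leq_pmull ?expn_gt0.
  move: (enc (s x)) => n; elim: n (z x) (s x) => [|n IH] b [|a s'] h //.
    by rewrite iterSr -IH.
  by rewrite iterSr -IH.
have hn : primrec (fun x => enc (s x)) by case: hs => phi hphi sE; exists phi.
apply/primrec_fst; apply: (primrec_iter hn (primrec_pair hz hs)).
apply: primrec_case; [exact/primrec_snd/primrec_snd/primrec_id|exact/primrec_snd/primrec_id|].
apply: primrec_pair; last exact/primrec_snd/primrec_snd/primrec_id.
apply: (primrec_comp (g := fun x : (G * (B * seq A)) * (A * seq A) => (x.1.1, (x.1.2.1, x.2.1))) hf).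
by do !primrec_basic.
Qed.

(** All other list functions are left folds, after a reversal if need be. *)
Lemma primrec_rev A {cA : Coded A} (s : G -> seq A) :
  primrec s -> primrec (fun x => rev (s x)).
Proof.
move=> hs.
have -> : (fun x => rev (s x)) = fun x => foldl (fun t a => a :: t) [::] (s x).
  by apply: funext => x; rewrite -[in RHS](revK (s x)) foldl_rev; elim: rev => //= a t <-.
by apply: primrec_foldl => //; do !primrec_basic.
Qed.

Lemma primrec_foldr A B {cA : Coded A} {cB : Coded B} (f : G -> A -> B -> B)
    (z : G -> B) (s : G -> seq A) :
  primrec (fun x : G * (A * B) => f x.1 x.2.1 x.2.2) -> primrec z -> primrec s ->
  primrec (fun x => foldr (f x) (z x) (s x)).
Proof.
move=> hf hz hs.
have -> : (fun x => foldr (f x) (z x) (s x)) =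
    fun x => foldl (fun b a => f x a b) (z x) (rev (s x)).
  by apply: funext => x; rewrite foldl_rev.
apply: primrec_foldl => //; last exact: primrec_rev.
apply: (primrec_comp (g := fun x : G * (B * A) => (x.1, (x.2.2, x.2.1))) hf).
by do !primrec_basic.
Qed.

Lemma primrec_map A B {cA : Coded A} {cB : Coded B} (f : G -> A -> B) (s : G -> seq A) :
  primrec (fun x : G * A => f x.1 x.2) -> primrec s -> primrec (fun x => map (f x) (s x)).
Proof.
move=> hf hs.
have -> : (fun x => map (f x) (s x)) = fun x => foldr (fun a t => f x a :: t) [::] (s x).
  by apply: funext => x; elim: (s x) => //= a t ->.
apply: primrec_foldr => //; last by primrec_basic.
primrec_basic; last by do !primrec_basic.
by apply: (primrec_comp (g := fun x : G * (A * seq B) => (x.1, x.2.1)) hf); do !primrec_basic.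
Qed.

Lemma primrec_cat A {cA : Coded A} (s t : G -> seq A) :
  primrec s -> primrec t -> primrec (fun x => s x ++ t x).
Proof.
move=> hs ht.
have -> : (fun x => s x ++ t x) = fun x => foldr cons (t x) (s x).
  by apply: funext => x; elim: (s x) => //= a t' ->.
by apply: primrec_foldr => //; do !primrec_basic.
Qed.

End Lists.

Section MoreLists.
Context {G : Type} {cG : Coded G}.

Lemma primrec_rcons A {cA : Coded A} (s : G -> seq A) (a : G -> A) :
  primrec s -> primrec a -> primrec (fun x => rcons (s x) (a x)).
Proof.
move=> hs ha; have -> : (fun x => rcons (s x) (a x)) = fun x => s x ++ [:: a x].
  by apply: funext => x; rewrite cats1.
by apply: primrec_cat => //; apply: primrec_cons => //; primrec_basic.
Qed.

Lemma primrec_flatten A {cA : Coded A} (s : G -> seq (seq A)) :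
  primrec s -> primrec (fun x => flatten (s x)).
Proof. by move=> hs; apply: primrec_foldr => //; [cbv beta; apply: primrec_cat|]; do !primrec_basic. Qed.

Lemma primrec_size A {cA : Coded A} (s : G -> seq A) :
  primrec s -> primrec (fun x => size (s x)).
Proof.
move=> hs; have -> : (fun x => size (s x)) = fun x => foldr (fun _ => succn) 0 (s x).
  by apply: funext => x; elim: (s x) => //= a t ->.
by apply: primrec_foldr => //; do !primrec_basic.
Qed.

Lemma primrec_has A {cA : Coded A} (p : G -> A -> bool) (s : G -> seq A) :
  primrec (fun x : G * A => p x.1 x.2) -> primrec s -> primrec (fun x => has (p x) (s x)).
Proof.
move=> hp hs.
have -> : (fun x => has (p x) (s x)) = fun x => foldr (fun a b => p x a || b) false (s x).
  by apply: funext => x; elim: (s x) => //= a t ->.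
apply: primrec_foldr => //; last by primrec_basic.
primrec_basic; last by do !primrec_basic.
by apply: (primrec_comp (g := fun x : G * (A * bool) => (x.1, x.2.1)) hp); do !primrec_basic.
Qed.

Lemma primrec_all A {cA : Coded A} (p : G -> A -> bool) (s : G -> seq A) :
  primrec (fun x : G * A => p x.1 x.2) -> primrec s -> primrec (fun x => all (p x) (s x)).
Proof.
move=> hp hs.
have -> : (fun x => all (p x) (s x)) = fun x => ~~ has (fun a => ~~ p x a) (s x).
  by apply: funext => x; rewrite has_predC negbK.
by apply/primrec_negb/primrec_has => //; apply: primrec_negb.
Qed.

Lemma primrec_behead A {cA : Coded A} (s : G -> seq A) :
  primrec s -> primrec (fun x => behead (s x)).
Proof. by move=> hs; apply: primrec_case => //; do !primrec_basic. Qed.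

Lemma primrec_head A {cA : Coded A} (a : A) (s : G -> seq A) :
  primrec s -> primrec (fun x => head a (s x)).
Proof. by move=> hs; apply: primrec_case => //; do !primrec_basic. Qed.

End MoreLists.

Section Indexing.
Context {G : Type} {cG : Coded G}.

Lemma primrec_nth A {cA : Coded A} (a : A) (s : G -> seq A) (n : G -> nat) :
  primrec s -> primrec n -> primrec (fun x => nth a (s x) (n x)).
Proof.
move=> hs hn.
have -> : (fun x => nth a (s x) (n x)) = fun x => head a (iter (n x) behead (s x)).
  apply: funext => x; elim: (n x) (s x) => [|k IH] t; first by rewrite nth0.
  by rewrite iterSr -IH nth_behead.
by apply/primrec_head/primrec_iter => //; apply/primrec_behead; do !primrec_basic.
Qed.

Lemma primrec_mkseq A {cA : Coded A} (f : G -> nat -> A) (n : G -> nat) :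
  primrec (fun x : G * nat => f x.1 x.2) -> primrec n -> primrec (fun x => mkseq (f x) (n x)).
Proof.
move=> hf hn; apply: primrec_map => //.
have -> : (fun x => iota 0 (n x)) = fun x => iter (n x) (fun s => rcons s (size s)) [::].
  apply: funext => x; elim: (n x) => // k IH; rewrite iterS -IH size_iota.
  by rewrite -cats1 -addn1 iotaD.
by apply: primrec_iter => //; [primrec_basic|apply: primrec_rcons; [|apply: primrec_size]; do !primrec_basic].
Qed.

End Indexing.

(** The rule before the last one undoes the eta-contractions that unification
    produces. *)
Ltac primrec_step := cbv beta; match goal with
  | |- primrec (fun _ => foldl _ _ _) => apply: primrec_foldl
  | |- primrec (fun _ => rev _) => apply: primrec_rev
  | |- primrec (fun _ => foldr _ _ _) => apply: primrec_foldr
  | |- primrec (fun _ => map _ _) => apply: primrec_map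
  | |- primrec (fun _ => _ ++ _) => apply: primrec_cat
  | |- primrec (fun _ => rcons _ _) => apply: primrec_rcons
  | |- primrec (fun _ => flatten _) => apply: primrec_flatten
  | |- primrec (fun _ => size _) => apply: primrec_size
  | |- primrec (fun _ => has _ _) => apply: primrec_has
  | |- primrec (fun _ => all _ _) => apply: primrec_all
  | |- primrec (fun _ => behead _) => apply: primrec_behead
  | |- primrec (fun _ => head _ _) => apply: primrec_head
  | |- primrec (fun _ => nth _ _ _) => apply: primrec_nth
  | |- primrec (fun _ => mkseq _ _) => apply: primrec_mkseq
  | |- primrec (fun _ => iter _ _ _) => apply: primrec_iter
  | |- primrec (fun _ => if _ is _ :: _ then _ else _) => apply: primrec_case
  | H : primrec ?f |- primrec ?f => exact: H
  | H : primrec ?f |- primrec (fun _ => ?f _) => apply: (primrec_comp H)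
  | |- @primrec ?A ?B ?cA ?cB ?f => lazymatch f with
      | (fun _ => _) => fail
      | _ => change (@primrec A B cA cB (fun x => f x))
      end
  | |- _ => primrec_basic
  end.
Ltac primrec_tac := repeat primrec_step.

(** * Simulating machines *)

(** Only finitely many work tapes are in use at any time; the list of these
    stands for all of them, missing entries being blank. *)
Definition tapes : Type := seq (seq nat * seq nat).

Definition get (w : tapes) (j : nat) : tape := nth ([::], [::]) w j.

Definition set_tape (w : tapes) (j : nat) (t : seq nat * seq nat) : tapes :=
  mkseq (fun i => if i == j then t else get w i) (size w + j.+1).

Lemma get_set w j t : get (set_tape w j t) = update (get w) j t.
Proof.
apply: funext => i; rewrite /get /set_tape /update.
have [lt|ge] := ltnP i (size w + j.+1); first by rewrite nth_mkseq.
rewrite nth_default ?size_mkseq // gtn_eqF; last by lia.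
by rewrite nth_default //; lia.
Qed.

(** Program counter, work tapes, input position and output. *)
Definition snapshot : Type := ((nat * tapes) * (nat * seq bool))%type.

Definition config_of (s : snapshot) : config :=
  Config s.1.1 (get s.1.2) s.2.1 s.2.2.

(** The execution of an instruction that is given by the list with its Goedel
    number; a list of any other form is an erasure. *)
Definition exec_code (c : seq nat) (inp : seq bool) (s : snapshot) : snapshot :=
  let k := s.1.1 in let w := s.1.2 in let i := s.2.1 in let o := s.2.2 in
  let op := nth 0 c 0 in let x := nth 0 c 1 in
  let a := nth 0 c 2 in let l := nth 0 c 3 in
  let t := get w x in
  if (size c == 2) && (op == 0) then
    ((k.+1, set_tape w x (behead t.1, head 0 t.1 :: t.2)), (i, o))
  else if (size c == 2) && (op == 1) then
    ((k.+1, set_tape w x (head 0 t.2 :: t.1, behead t.2)), (i, o))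
  else if (size c == 3) && (op == 2) then
    ((k.+1, set_tape w x (t.1, a :: behead t.2)), (i, o))
  else if (size c == 4) && (op == 3) then
    ((if head 0 t.2 == a then l else k.+1, w), (i, o))
  else if (size c == 3) && (op == 4) then
    ((if nth false inp i == ~~ (x == 0) then a else k.+1, w), (i, o))
  else if (size c == 1) && (op == 5) then ((k.+1, w), (i.+1, o))
  else if (size c == 2) && (op == 6) then ((k.+1, w), (i, rcons o (~~ (x == 0))))
  else ((k.+1, w), (i, [::])).

Definition step_code (e : seq nat) (inp : seq bool) (s : snapshot) : snapshot :=
  if s.1.1 < size e then exec_code (CodeSeq.decode (nth 0 e s.1.1)) inp s else s.

Definition simulate (e : nat) (inp : seq bool) (t : nat) : snapshot :=
  iter t (step_code (CodeSeq.decode e) inp) ((0, [::]), (0, [::])).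

Lemma exec_codeE n inp p s : input_bit p s.2.1 = nth false inp s.2.1 ->
  config_of (exec_code (CodeSeq.decode n) inp s) = exec p (decode_instr n) (config_of s).
Proof.
move=> sinp; rewrite /decode_instr; case: (CodeSeq.decode n) => [|op c] //.
case: s sinp => [[k w] [i o]] /= sinp.
case: c => [|x [|a [|l [|? ?]]]];
  case: op => [|[|[|[|[|[|[|op]]]]]]] //=; rewrite /config_of /exec_code /= ?get_set //.
by rewrite sinp.
Qed.

Lemma step_codeE e inp p s : input_bit p s.2.1 = nth false inp s.2.1 ->
  config_of (step_code (CodeSeq.decode e) inp s) = step (decode_program e) p (config_of s).
Proof.
move=> sinp; rewrite /step_code /step /decode_program onth_map.
rewrite [pc _]/=; case: ltnP => h; last by rewrite onth_default.
by rewrite onthE (nth_map 0) //= (exec_codeE _ sinp).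
Qed.

Lemma inpos_exec_code c inp s : (exec_code c inp s).2.1 <= s.2.1.+1.
Proof. by rewrite /exec_code; do !case: ifP => _ /=. Qed.

(** In t steps the input head reads no bit beyond the first t, so that a finite
    part of the input determines the run. *)
Lemma simulateE e inp p t :
  (forall i, i < t -> input_bit p i = nth false inp i) ->
  config_of (simulate e inp t) = run (decode_program e) p t.
Proof.
move=> h; suff [] : config_of (simulate e inp t) = run (decode_program e) p t /\
  (simulate e inp t).2.1 <= t by [].
elim: t h => [|t IH] h.
  by split=> //; congr Config; apply: funext => j; rewrite /get nth_nil.
have [i it|e1 e2] := IH; first by apply: h; apply: leqW.
rewrite /simulate /run !iterS -/(simulate _ _ _) -/(run _ _ _) -e1; split.
  by apply: step_codeE; apply: h.
rewrite /step_code; case: ifP => _; last exact: leqW.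
exact: leq_trans (inpos_exec_code _ _ _) _.
Qed.

Section PrSimulate.
Context {G : Type} {cG : Coded G}.

Lemma primrec_get (w : G -> tapes) (j : G -> nat) : primrec w -> primrec j ->
  primrec (fun x => (get (w x) (j x) : seq nat * seq nat)).
Proof. exact: primrec_nth. Qed.

Lemma primrec_set (w : G -> tapes) (j : G -> nat) (t : G -> seq nat * seq nat) :
  primrec w -> primrec j -> primrec t -> primrec (fun x => set_tape (w x) (j x) (t x)).
Proof.
move=> hw hj ht; by rewrite /set_tape /get; primrec_tac.
Qed.

Lemma primrec_exec_code (c : G -> seq nat) (inp : G -> seq bool) (s : G -> snapshot) :
  primrec c -> primrec inp -> primrec s -> primrec (fun x => exec_code (c x) (inp x) (s x)).
Proof.
move=> hc hi hs; rewrite /exec_code; cbv zeta.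
by by repeat match goal with
  | |- primrec (fun _ => get _ _) => apply: primrec_get
  | |- primrec (fun _ => set_tape _ _ _) => apply: primrec_set
  | |- _ => primrec_step
  end.
Qed.

End PrSimulate.

Lemma primrec_simulate {G : Type} {cG : Coded G} (e : G -> nat) (inp : G -> seq bool) (t :
  G -> nat) :
  primrec e -> primrec inp -> primrec t -> primrec (fun x => simulate (e x) (inp x) (t x)).
Proof.
by move=> he hi ht; rewrite /simulate /step_code; primrec_tac; apply: primrec_exec_code; primrec_tac.
Qed.

(** * Reading words off an output tape *)

(** The numbers that are complete on the tape; the ones at its end, still
    without a delimiter, are dropped. *)
Definition parse (o : seq bool) : seq nat :=
  foldr (fun b v => if b then (if v is n :: v' then n.+1 :: v' else [::])
                    else 0 :: v) [::] o.

Lemma parse_unary s o : parse (unary s ++ o) = s ++ parse o.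
Proof.
elim: s => //= n s IH; rewrite -!catA cat_rcons /parse foldr_cat -/(parse _) /=.
by rewrite -/(parse _) IH; elim: n => //= n ->.
Qed.

Lemma parse_prefix o o' : prefix o o' -> prefix (parse o) (parse o').
Proof.
move=> /prefixP[r ->]; elim: o => [|[] o IH] /=; first exact: prefix0s.
  rewrite -/(parse _); move: IH; case: (parse o) => [_|n v]; first exact: prefix0s.
  by case: (parse (o ++ r)) => //= n' v' /andP[/eqP -> ->]; rewrite eqxx.
exact: IH.
Qed.

Definition result (M : program) (p : baire) (t : nat) : seq nat :=
  parse (out (run M p t)).

Lemma step_out M p s : ~~ (if onth M (pc s) is Some c then is_erase c else false) ->
  prefix (out s) (out (step M p s)).
Proof.
rewrite /step; case: onth => [c|] ; last by rewrite prefix_refl.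
by case: s => k f i o; case: c => //= *; rewrite ?prefix_refl // prefix_rcons.
Qed.

Lemma out_mono M p t0 t t' : (forall t, t0 <= t -> ~~ erases_at M p t) ->
  t0 <= t -> t <= t' -> prefix (out (run M p t)) (out (run M p t')).
Proof.
move=> noE t0t /subnK <-; elim: (t' - t) => [|k IH]; first exact: prefix_refl.
apply: prefix_trans IH _; rewrite addSn /run iterS; apply: step_out.
by apply: noE; apply: leq_trans t0t (leq_addl _ _).
Qed.

Lemma result_mono M p t t' : ~~ has is_erase M -> t <= t' ->
  prefix (result M p t) (result M p t').
Proof.
by move=> noM tt'; apply/parse_prefix/(@out_mono _ _ 0) => // u _; exact: noerase_erases_at.
Qed.

Lemma prefix_total (T : eqType) (s1 s2 s : seq T) : size s1 <= size s2 ->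
  prefix s1 s -> prefix s2 s -> prefix s1 s2.
Proof.
move=> le /prefixP[r1 ->] /prefixP[r2] /(congr1 (take (size s1))).
rewrite take_size_cat // takel_cat // => e.
by apply/prefixP; exists (drop (size s1) s2); rewrite {1}e cat_take_drop.
Qed.

(** After the last erasure every word on the output tape is a prefix of the
    result, since otherwise the output could not grow to arbitrarily long
    prefixes of the result. *)
Lemma writes_result M p q : writes M p q -> exists t0,
  (forall t, t0 <= t -> exists n, prefix (result M p t) (mkseq q n)) /\
  (forall n, exists t1, forall t, t1 <= t -> prefix (mkseq q n) (result M p t)).
Proof.
move=> [t0 [noE wq]]; exists t0; split.
  move=> t t0t; pose n := (size (out (run M p t))).+1; exists n.
  have [t' t0t' qt'] := wq n.
  have szn : size (out (run M p t)) < size (unary (mkseq q n)).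
    by rewrite (leq_trans _ (size_unary _)) // size_mkseq.
  rewrite -[mkseq q n]cats0 -[[::]]/(parse [::]) -parse_unary cats0.
  apply: parse_prefix; have [tt'|t't] := leqP t t'.
    by apply: prefix_total (ltnW szn) (out_mono noE t0t tt') qt'.
  have := prefix_trans qt' (out_mono noE t0t' (ltnW t't)) => /size_prefix.
  by rewrite leqNgt szn.
move=> n; have [t1 t01 qt1] := wq n; exists t1 => t t1t.
have /parse_prefix := prefix_trans qt1 (out_mono noE t01 t1t).
by rewrite -[unary _]cats0 parse_unary cats0.
Qed.

(** * Approximating the Turing jump *)

Definition halts_by (n m t : nat) : bool :=
  size (CodeSeq.decode n) <= (simulate n (nseq m true) t).1.1.

Lemma unary_zeros k : unary (nseq k 0) = nseq k false.
Proof. by rewrite /unary map_nseq; elim: k => //= k ->. Qed.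

Lemma input_bit_number_input m i :
  input_bit (number_input m) i = nth false (nseq m true) i.
Proof.
have -> : input_bit (number_input m) i = nth false (unary (m :: nseq i 0)) i.
  rewrite /input_bit /mkseq /= -[1]addn0 iotaDl -map_comp.
  congr (nth _ (unary (_ :: _)) _); apply: (@eq_from_nth _ 0).
    by rewrite size_map size_iota size_nseq.
  move=> j; rewrite size_map size_iota => ji.
  by rewrite (nth_map 0) ?size_iota // nth_nseq ji.
rewrite /unary /= -/(unary _) unary_zeros nth_cat size_rcons size_nseq nth_rcons size_nseq.
rewrite !nth_nseq; case: (ltngtP i m) => [lt||->]; rewrite ?ltnS ?leqnn ?(ltnW lt) //.
by move=> mi; rewrite leqNgt mi /= if_same.
Qed.

Lemma halts_byE n m t :
  halts_by n m t = (size (decode_program n) <= pc (run (decode_program n) (number_input m) t)).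
Proof.
rewrite -(@simulateE n (nseq m true)) ?size_map // => i _.
exact: input_bit_number_input.
Qed.

Lemma halts_by_mono n m t t' : t <= t' -> halts_by n m t -> halts_by n m t'.
Proof.
rewrite !halts_byE => /subnK <- h; elim: (t' - t) => // k IH.
by rewrite addSn /run iterS -/(run _ _ _) /step onth_default.
Qed.

Lemma ce_wordsE n w : ce_words n w <-> exists t, halts_by n (CodeSeq.code w) t.
Proof. by split=> [] [t] h; exists t; move: h; rewrite halts_byE. Qed.

(** Whether the prefix v of a point is long enough to place the point in the
    n-th c.e. open set within t steps. *)
Definition accepts (n t : nat) (v : seq nat) : bool :=
  has (fun l => halts_by n (CodeSeq.code (mkseq (nth 0 v) l)) t) (mkseq id (size v).+1).

Lemma acceptsP n t v : reflect
  (exists2 l, l <= size v & halts_by n (CodeSeq.code (take l v)) t) (accepts n t v).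
Proof.
have mkE l : l <= size v -> mkseq (nth 0 v) l = take l v.
  by move=> lv; rewrite /mkseq map_nth_iota0.
apply: (iffP hasP) => [[l]|[l lv h]].
  by move=> /mapP[k + ->]; rewrite mem_iota ltnS => /= kv; rewrite mkE //; exists k.
exists l; last by rewrite mkE.
by apply/mapP; exists l; rewrite ?mem_iota.
Qed.

Lemma accepts_mono n t t' v v' : t <= t' -> prefix v v' ->
  accepts n t v -> accepts n t' v'.
Proof.
move=> tt' /prefixP[r ->] /acceptsP[l lv h]; apply/acceptsP; exists l.
  by rewrite size_cat (leq_trans lv) ?leq_addr.
by rewrite takel_cat //; apply: halts_by_mono h.
Qed.

Lemma accepts_sound n t v k q : prefix v (mkseq q k) -> accepts n t v -> ce_open n q.
Proof.
move=> vq /acceptsP[l lv h].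
have vk : size v <= k by rewrite -[k](size_mkseq q) size_prefix.
exists (take l v); first by apply/ce_wordsE; exists t.
rewrite /cylinder /mkset size_takel //.
move: vq => /prefixP[r e]; have := congr1 (take l) e.
rewrite takel_cat // => <-; rewrite /mkseq -map_take take_iota.
by rewrite (minn_idPl (leq_trans lv vk)).
Qed.

(** Membership in a c.e. open set is witnessed by a prefix and a running
    time. *)
Lemma accepts_complete n q : ce_open n q -> exists k t0, forall t v,
  t0 <= t -> prefix (mkseq q k) v -> accepts n t v.
Proof.
move=> [w /ce_wordsE[t0 h] wq]; exists (size w), t0 => t v tt /prefixP[r ->].
apply/acceptsP; exists (size w); first by rewrite size_cat size_mkseq leq_addr.
by rewrite take_size_cat ?size_mkseq // wq; apply: halts_by_mono h.
Qed.

(** Testing the current output of a machine with finitely many mind changes for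
    membership in the n-th c.e. open set gives, in the limit, the n-th value of
    the jump of the final result: after the last erasure only prefixes of the
    result are tested, so that a positive answer is correct, and a positive
    answer that is correct is found eventually. *)
Lemma writes_accepts M p q n : writes M p q -> exists t0, forall t, t0 <= t ->
  (accepts n t (result M p t) : nat) = jump q n.
Proof.
move=> /writes_result[t0 [sub sup]]; rewrite /jump; case: asboolP => qn.
  have [k [t1 acc]] := accepts_complete qn; have [t2 qt] := sup k.
  exists (maxn t1 t2) => t; rewrite geq_max => /andP[h1 h2].
  by rewrite acc // qt.
exists t0 => t /sub[k vk]; case E : (accepts _ _ _) => //; case: qn.
exact: accepts_sound vk E.
Qed.

(** * Limits in Baire space *)

Lemma low_rep_lim (X : represented_space) (r q : baire) (y : X) :
  (forall n, exists s0, forall s, s0 <= s -> r (Cantor.to_nat (s, n)) = jump q n) ->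
  rep X q = Some y -> low_rep X r = Some y.
Proof.
move=> rq qy; have rcvg : component r @ \oo --> jump q.
  apply/(pointwise_cvgP (V := nat)) => n A /nbhs_singleton An.
  have [s0 h] := rq n; exists s0 => // s /= /h; rewrite /component => ->.
  exact: An.
have hB : hausdorff_space baire.
  by apply: hausdorff_product => i; exact: discrete_hausdorff.
rewrite /low_rep /baire_lim asboolT; last by apply/cvg_ex; exists (jump q).
rewrite (cvg_lim hB rcvg) /= /jump_inv asboolT /=; last by exists q.
by rewrite pinvKV ?inE // => ? ? _ _; exact: jump_inj.
Qed.

Lemma primrec_of_nat {G : Type} {cG : Coded G} (n : G -> nat) :
  primrec n -> primrec (fun x => Cantor.of_nat (n x)).
Proof.
move=> hn; pose next x := if x.1 == 0 then (x.2.+1, 0) else (x.1.-1, x.2.+1).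
have -> : (fun x => Cantor.of_nat (n x)) = fun x => iter (n x) next (0, 0).
  apply: funext => x; elim: (n x) => // k IH; rewrite iterS -IH.
  change (Cantor.of_nat k.+1) with (let '(i, j) := Cantor.of_nat k in
    if i is i'.+1 then (i', j.+1) else (j.+1, 0)).
  by case: (Cantor.of_nat k) => -[|i] j.
by rewrite /next; primrec_tac.
Qed.

Lemma primrec_parse {G : Type} {cG : Coded G} (o : G -> seq bool) :
  primrec o -> primrec (fun x => parse (o x)).
Proof. by move=> ho; rewrite /parse; primrec_tac. Qed.

Lemma primrec_nseq {G : Type} {cG : Coded G} A {cA : Coded A} (n : G -> nat) (a : A) :
  primrec n -> primrec (fun x => nseq (n x) a).
Proof.
move=> hn; have -> : (fun x => nseq (n x) a) = fun x => iter (n x) (cons a) [::].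
  by apply: funext => x; elim: (n x) => //= k ->.
by primrec_tac.
Qed.

Lemma primrec_unary {G : Type} {cG : Coded G} (s : G -> seq nat) :
  primrec s -> primrec (fun x => unary (s x)).
Proof. by move=> hs; rewrite /unary; primrec_tac; apply: primrec_nseq; primrec_tac. Qed.

Lemma primrec_accepts {G : Type} {cG : Coded G} (n t : G -> nat) (v : G -> seq nat) :
  primrec n -> primrec t -> primrec v -> primrec (fun x => accepts (n x) (t x) (v x)).
Proof.
move=> hn ht hv; rewrite /accepts /halts_by; primrec_tac.
by apply: primrec_simulate; primrec_tac; apply: primrec_nseq; primrec_tac.
Qed.

(** It suffices to compute bits b(s, n) that converge to the n-th value of the
    jump of the result as s grows. At the time when the entry with number
    k = <s, n> of the output is due, a prefix of length k + 1 > s of the input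
    has been read, which is all that b(s, n) may depend on. *)
Lemma low_computable_stages (X Y : represented_space) (f : X -> set Y)
    (b : seq nat -> nat -> nat -> bool) :
  primrec (fun x : seq nat * (nat * nat) => b x.1 x.2.1 x.2.2) ->
  (forall p x, rep X p = Some x -> mdom f x -> exists q y,
    [/\ rep Y q = Some y, f x y &
        forall n, exists s0, forall s k, s0 <= s -> s <= k ->
          (b (mkseq p k) s n : nat) = jump q n]) ->
  low_computable f.
Proof.
move=> hb hf.
pose phi (w : seq nat) : bool :=
  b (rev w) (Cantor.of_nat (size w).-1).1 (Cantor.of_nat (size w).-1).2.
have [F hF FE] : primrec phi.
  apply: (primrec_comp (g := fun w => (rev w, Cantor.of_nat (size w).-1)) hb).
  by primrec_tac; apply: primrec_of_nat; primrec_tac.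
eexists; first exact: stagewise_computable hF.
move=> p x px fx; have [q [y [qy fxy lim]]] := hf p x px fx.
eexists; exists y; split=> //.
apply: low_rep_lim qy => n; have [s0 h] := lim n; exists s0 => s s0s.
rewrite -[CodeSeq.code _]/(enc (rev (mkseq p (Cantor.to_nat (s, n)).+1))) FE.
rewrite /phi revK size_rev size_mkseq succnK Cantor.cancel_of_to.
apply: h => //; apply: leqW.
by have /leP := Cantor.to_nat_non_decreasing s n; apply: leq_trans (leq_addl n s).
Qed.

(** * Finitely many mind changes *)

Definition simulated (e : nat) (w : seq nat) (s : nat) : seq nat :=
  parse (simulate e (unary w) s).2.2.

Lemma primrec_simulated {G : Type} {cG : Coded G} (e : nat) (w : G -> seq nat) (s :
  G -> nat) :
  primrec w -> primrec s -> primrec (fun x => simulated e (w x) (s x)).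
Proof.
by move=> hw hs; apply: primrec_parse; primrec_tac; apply: primrec_simulate; primrec_tac; apply: primrec_unary.
Qed.

Lemma simulatedE e p s k : s <= k ->
  simulated e (mkseq p k) s = result (decode_program e) p s.
Proof.
move=> sk; rewrite /result -(@simulateE e (unary (mkseq p k))) // => i si.
by apply: input_bitE; apply: leq_trans sk.
Qed.

Lemma mind_change_low (X Y : represented_space) (f : X -> set Y) :
  mind_change_computable f -> low_computable f.
Proof.
move=> [M hM]; have [e eM] := decode_program_surj M.
apply: (low_computable_stages (b := fun w s n => accepts n s (simulated e w s))).
  by apply: primrec_accepts; primrec_tac; apply: primrec_simulated; primrec_tac.
move=> p x px fx; have [q [y [wq qy fxy]]] := hM p x px fx.
exists q, y; split=> // n; have [s0 h] := writes_accepts n wq.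
by exists s0 => s k s0s sk; rewrite simulatedE // eM h.
Qed.

(** * Compactness of Cantor space *)

Definition binary (x : nat -> nat) : Prop := forall i, x i < 2.

(** If every stage leaves some binary sequence alive, then some binary sequence
    is never killed: words with extensions alive at all stages form an infinite
    tree, of which x is a branch. *)
Lemma konig (K : nat -> (nat -> nat) -> Prop) :
  (forall s s' x, s <= s' -> K s x -> K s' x) ->
  (forall s x y, mkseq x s = mkseq y s -> K s x -> K s y) ->
  (forall s, exists2 x, binary x & ~ K s x) ->
  exists2 x, binary x & forall s, ~ K s x.
Proof.
move=> mono ext hK.
pose bad w := forall s, exists2 x, binary x & mkseq x (size w) = w /\ ~ K s x.
have step w : exists a, bad w -> a < 2 /\ bad (rcons w a).
  have [b0|] := pselect (bad (rcons w 0)); first by exists 0.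
  move=> /existsNP[s0 n0]; exists 1 => bw; split=> // s.
  have [x bx [xw nKx]] := bw (maxn s0 s); exists x => //; split; last first.
    by apply: contra_not nKx; apply: mono; apply: leq_maxr.
  rewrite size_rcons mkseqS xw; congr rcons.
  case E : (x (size w)) (bx (size w)) => [|[|//]] // _; case: n0; exists x => //; split.
    by rewrite size_rcons mkseqS xw E.
  by apply: contra_not nKx; apply: mono; apply: leq_maxl.
have [f hf] := choice step.
pose W n := iter n (fun w => rcons w (f w)) [::].
have sW n : size (W n) = n by elim: n => //= n IH; rewrite size_rcons IH.
have bW n : bad (W n).
  elim: n => [s|n /hf[]//]; have [x bx nK] := hK s.
  by exists x.
pose x i := f (W i).
have xW n : mkseq x n = W n by elim: n => //= n IH; rewrite mkseqS IH.
exists x => [i|s Ks]; first by have [] := hf _ (bW i).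
have [y by_ [yW nKy]] := bW s s; apply: nKy.
by apply: ext Ks; rewrite xW -yW sW.
Qed.

Definition words (s : nat) : seq (seq nat) :=
  iter s (fun L => map (cons 0) L ++ map (cons 1) L) [:: [::]].

Lemma wordsP s u : (u \in words s) = (size u == s) && all (fun a => a < 2) u.
Proof.
elim: s u => [|s IH] u; first by rewrite inE; case: u.
rewrite /words iterS -/(words s) mem_cat.
case: u => [|a u].
  by apply/negbTE/norP; split; apply/mapP => -[].
have consE b : (a :: u \in map (cons b) (words s)) = (a == b) && (u \in words s).
  apply/mapP/andP => [[v vs [-> ->]]//|[/eqP -> us]]; by exists u.
rewrite !consE IH /= eqSS; case: a {consE} => [|[|a]] //=; rewrite ?orbF //.
by rewrite andbF.
Qed.

(** This is what makes a condition on all points of Cantor space decidable at a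
    given stage. *)
Lemma all_words (K : pred (nat -> nat)) s :
  (forall x y, mkseq x s = mkseq y s -> K x -> K y) ->
  all (fun u => K (nth 0 u)) (words s) <-> forall x, binary x -> K x.
Proof.
move=> ext; split=> [/allP h x bx|h].
  apply: (ext (nth 0 (mkseq x s))); last first.
    apply: h; rewrite wordsP size_mkseq eqxx /=.
    by apply/allP => _ /mapP[i _ ->]; exact: bx.
  apply/eq_in_map => i; rewrite mem_iota => /= is_.
  by rewrite nth_mkseq.
apply/allP => u; rewrite wordsP => /andP[_ /allP uP]; apply: h => i.
have [iu|ui] := ltnP i (size u); first exact/uP/mem_nth.
by rewrite nth_default.
Qed.

(** * Low points of closed sets *)

(** For a fixed input p, the machine MH lists the complement of a closed set A,
    and MK turns the points of A into results. As in the low basis theorem, a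
    point of A is sought whose result has a jump that is a limit of guesses. *)
Section LowBasis.
Variables (MH MK : program) (p : baire).
Hypothesis noH : ~~ has is_erase MH.
Hypothesis noK : ~~ has is_erase MK.

(** x lies outside A, as seen at stage s. *)
Definition removed (s : nat) (x : nat -> nat) : bool :=
  has (fun c => has (fun l => c == (CodeSeq.code (mkseq x l)).+1) (mkseq id s.+1))
    (result MH p s).

(** The result of x lies in the n-th c.e. open set, as seen at stage s. *)
Definition enters (n s : nat) (x : nat -> nat) : bool :=
  accepts n s (result MK (baire_pair p x) s).

(** A list C of bits stands for the closed set of the points of A whose results
    avoid the m-th c.e. open set whenever entry m of C is false. *)
Definition killed (C : seq bool) (s : nat) (x : nat -> nat) : bool :=
  removed s x ||
  has (fun m => ~~ nth true C m && enters m s x) (mkseq id (size C)).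

(** The n-th bit is true if, with the earlier bits given, avoiding the n-th
    c.e. open set leaves no point. Stage s can only check this for the points
    that are killed by then; the true bits are [decisions]. *)
Definition guess (s n : nat) : seq bool :=
  iter n (fun C => rcons C
    (all (fun u => killed (rcons C false) s (nth 0 u)) (words s))) [::].

Definition decisions (n : nat) : seq bool :=
  iter n (fun C => rcons C
    `[< exists s, forall x, binary x -> killed (rcons C false) s x >]) [::].

Lemma size_decisions n : size (decisions n) = n.
Proof. by elim: n => //= n IH; rewrite size_rcons IH. Qed.

Lemma killedP C s x : reflect
  (removed s x \/ exists m, [/\ m < size C, nth true C m = false & enters m s x])
  (killed C s x).
Proof.
apply: (iffP orP) => -[h|]; [by left| |by left|].
  move=> /hasP[m /mapP[k + ->]]; rewrite mem_iota => /= kC /andP[/negbTE h1 h2].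
  by right; exists k.
move=> [m [mC h1 h2]]; right; apply/hasP; exists m; last by rewrite h1.
by apply/mapP; exists m; rewrite ?mem_iota.
Qed.

Lemma killed_rconsT C s x : killed (rcons C true) s x = killed C s x.
Proof.
apply/killedP/killedP => -[h|[m]]; [by left| |by left|].
  rewrite size_rcons nth_rcons => -[]; case: (ltngtP m (size C)) => // mC _ h1 h2.
  by right; exists m.
move=> [mC h1 h2]; right; exists m; rewrite size_rcons nth_rcons mC.
by split=> //; apply: leqW.
Qed.

Lemma killed_rconsF C s x :
  killed (rcons C false) s x = killed C s x || enters (size C) s x.
Proof.
apply/killedP/orP.
  move=> [h|[m]]; first by left; apply/killedP; left.
  rewrite size_rcons nth_rcons => -[]; case: (ltngtP m (size C)) => // [mC _ h1 h2|-> _ _ ?].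
    by left; apply/killedP; right; exists m.
  by right.
move=> [/killedP[h|[m [mC h1 h2]]]|h]; first by left.
  by right; exists m; rewrite size_rcons nth_rcons mC leqW.
by right; exists (size C); rewrite size_rcons nth_rcons ltnn eqxx.
Qed.

Lemma killed_mono C s s' x : s <= s' -> killed C s x -> killed C s' x.
Proof.
move=> ss' /killedP[h|[m [mC h1 h2]]]; apply/killedP; [left|right].
  move: h; have /prefixP[r eR] := result_mono p noH ss'.
  move=> /hasP[c cR /hasP[l /mapP[k + ->] cE]]; rewrite mem_iota /= => ks.
  apply/hasP; exists c; first by rewrite eR mem_cat cR.
  apply/hasP; exists k => //; apply/mapP; exists k => //.
  by rewrite mem_iota /= (leq_trans ks).
by exists m; split=> //; apply: accepts_mono h2 => //; exact: result_mono.
Qed.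

Lemma pair_mkseq x y n s : s <= n -> mkseq x n = mkseq y n ->
  mkseq (baire_pair p x) s = mkseq (baire_pair p y) s.
Proof.
move=> sn /eq_in_map xy; apply/eq_in_map => i; rewrite mem_iota => /= is_.
rewrite /baire_pair; case: odd => //; apply: xy; rewrite mem_iota /=.
apply: leq_ltn_trans (leq_trans is_ sn).
by rewrite -{2}[i]odd_double_half -addnn addnA leq_addl.
Qed.

Lemma result_ext M p' p'' s :
  mkseq p' s = mkseq p'' s -> result M p' s = result M p'' s.
Proof.
move=> pp; have [e eM] := decode_program_surj M.
by rewrite -eM -!(@simulatedE _ _ _ s) // pp.
Qed.

Lemma killed_ext C s x y : mkseq x s = mkseq y s -> killed C s x -> killed C s y.
Proof.
move=> xy /killedP[h|[m [mC h1 h2]]]; apply/killedP; [left|right].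
  move: h => /hasP[c cR /hasP[l /mapP[k + ->] cE]]; rewrite mem_iota /= => ks.
  apply/hasP; exists c => //; apply/hasP; exists k; last first.
    rewrite (eqP cE); apply/eqP; congr (CodeSeq.code _).+1.
    have := congr1 (take k) xy.
    by rewrite /mkseq -!map_take take_iota (minn_idPl _).
  by apply/mapP; exists k; rewrite ?mem_iota.
exists m; split=> //; move: h2; rewrite /enters.
by rewrite (result_ext _ (pair_mkseq (leqnn s) xy)).
Qed.

(** When the earlier bits have settled, the n-th guess can only change from
    false to true, since a set that is empty at one stage is empty at all later
    ones. *)
Lemma guess_decisions n : exists s0, forall s, s0 <= s -> guess s n = decisions n.
Proof.
elim: n => [|n [s0 IH]]; first by exists 0.
have gE s : s0 <= s -> guess s n.+1 = rcons (decisions n)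
    (all (fun u => killed (rcons (decisions n) false) s (nth 0 u)) (words s)).
  by move=> /IH <-.
have awP s := all_words (@killed_ext (rcons (decisions n) false) s).
have [[s1 h1]|nh] := pselect (exists s, forall x, binary x ->
    killed (rcons (decisions n) false) s x).
  exists (maxn s0 s1) => s; rewrite geq_max => /andP[s0s s1s].
  rewrite gE // /decisions iterS -/(decisions n) asboolT; last by exists s1.
  congr rcons; apply/awP => x bx.
  exact: killed_mono s1s (h1 x bx).
exists s0 => s s0s; rewrite gE // /decisions iterS -/(decisions n) asboolF //.
by congr rcons; apply/negbTE/negP => /awP h; apply: nh; exists s.
Qed.

Lemma decisions_mono n n' s x : n <= n' ->
  killed (decisions n) s x -> killed (decisions n') s x.
Proof.
move=> /subnK <-; elim: (n' - n) => // k IH /IH h.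
rewrite addSn /decisions iterS -/(decisions _); case: asbool.
  by rewrite killed_rconsT.
by rewrite killed_rconsF h.
Qed.

(** By the choice of the bits each of the closed sets in the decreasing sequence
    is nonempty, and by compactness so is their intersection. A point of it has
    a result that enters exactly those c.e. open sets that it cannot avoid. *)
Lemma low_point : (exists2 x, binary x & forall s, ~~ removed s x) ->
  exists x, [/\ binary x, forall s, ~~ removed s x &
    forall n, nth false (decisions n.+1) n <-> exists s, enters n s x].
Proof.
move=> [x0 bx0 nrx0].
have unkilled n : exists2 x, binary x & forall s, ~ killed (decisions n) s x.
  elim: n => [|n [x bx nK]].
    by exists x0 => // s; rewrite /killed /= orbF; exact/negP.
  rewrite /decisions iterS -/(decisions n); case: asboolP => [_|nh].
    by exists x => // s; rewrite killed_rconsT.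
  apply: (@konig (killed (rcons (decisions n) false))).
  - by move=> s s' y; exact: killed_mono.
  - by move=> s y z; exact: killed_ext.
  move=> s; apply: contra_notP nh => nh; exists s => y by_.
  by apply: contrapT => nky; apply: nh; exists y.
have [x bx nK] : exists2 x, binary x & forall s, ~ killed (decisions s) s x.
  apply: (@konig (fun s => killed (decisions s) s)).
  - by move=> s s' y ss' k; exact: (killed_mono ss' (decisions_mono ss' k)).
  - by move=> s y z; exact: killed_ext.
  by move=> s; have [y by_ nk] := unkilled s; exists y.
have {}nK n s : ~ killed (decisions n) s x.
  move=> k; apply: (nK (maxn n s)); apply: decisions_mono (leq_maxl n s) _.
  exact: killed_mono (leq_maxr n s) k.
exists x; split=> // [s|n].
  by apply/negP => r; apply: (nK 0 s); apply/killedP; left.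
have dE : decisions n.+1 = rcons (decisions n)
  `[< exists s, forall x, binary x -> killed (rcons (decisions n) false) s x >] by [].
rewrite dE nth_rcons size_decisions ltnn eqxx; split=> [/asboolP[s /(_ x bx)]|[s es]].
  rewrite killed_rconsF size_decisions => /orP[/nK//|].
  by exists s.
apply: contrapT => /negP nb; apply: (nK n.+1 s).
rewrite dE (negbTE nb) killed_rconsF size_decisions es.
exact: orbT.
Qed.

End LowBasis.

Lemma primrec_words {G : Type} {cG : Coded G} (s : G -> nat) :
  primrec s -> primrec (fun x => words (s x)).
Proof. by move=> hs; rewrite /words; primrec_tac. Qed.

(** * The stages as functions of a prefix of the input *)

Definition pair_prefix (w u : seq nat) (s : nat) : seq nat :=
  mkseq (baire_pair (nth 0 w) (nth 0 u)) s.

Definition killed_code (eH eK : nat) (w : seq nat) (C : seq bool) (s : nat) (u : seq nat) : bool :=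
  has (fun c => has (fun l => c == (CodeSeq.code (mkseq (nth 0 u) l)).+1) (mkseq id s.+1))
    (simulated eH w s) ||
  has (fun m => ~~ nth true C m && accepts m s (simulated eK (pair_prefix w u s) s))
    (mkseq id (size C)).

Definition guess_code (eH eK : nat) (w : seq nat) (s n : nat) : seq bool :=
  iter n (fun C => rcons C
    (all (fun u => killed_code eH eK w (rcons C false) s u) (words s))) [::].

Lemma guess_codeE eH eK p k s n : s <= k ->
  guess_code eH eK (mkseq p k) s n = guess (decode_program eH) (decode_program eK) p s n.
Proof.
move=> sk; elim: n => // n IH; rewrite /guess_code /guess !iterS.
rewrite -/(guess_code _ _ _ _ _) -/(guess _ _ _ _ _) IH; congr rcons.
apply: eq_all => u; rewrite /killed_code /killed /removed simulatedE //.
congr (_ || _); apply: eq_has => m; rewrite /enters; congr (_ && accepts _ _ _).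
rewrite -(@simulatedE _ _ _ s) //; congr simulated.
apply/eq_in_map => i; rewrite mem_iota => /= is_; rewrite /baire_pair.
case: odd => //; rewrite nth_mkseq // (leq_trans _ sk) //.
apply: leq_ltn_trans is_.
by rewrite -{2}[i]odd_double_half -addnn addnA leq_addl.
Qed.

Lemma primrec_half {G : Type} {cG : Coded G} (n : G -> nat) :
  primrec n -> primrec (fun x => (n x)./2).
Proof.
by apply: (@primrec_comp _ _ _ _ _ _ half); exists half => // b E hE; exact: expr_half.
Qed.

Lemma primrec_odd {G : Type} {cG : Coded G} (n : G -> nat) :
  primrec n -> primrec (fun x => odd (n x)).
Proof.
apply: (@primrec_comp _ _ _ _ _ _ odd); exists (fun n => nat_of_bool (odd n)) => // b E hE.
exact: expr_odd.
Qed.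

Lemma primrec_pair_prefix {G : Type} {cG : Coded G} (w u : G -> seq nat) (s :
  G -> nat) :
  primrec w -> primrec u -> primrec s -> primrec (fun x => pair_prefix (w x) (u x) (s x)).
Proof.
move=> hw hu hs; rewrite /pair_prefix /baire_pair.
by repeat match goal with
  | |- primrec (fun _ => odd _) => apply: primrec_odd
  | |- primrec (fun _ => _./2) => apply: primrec_half
  | |- _ => primrec_step
  end.
Qed.

Lemma primrec_guess_code eH eK :
  primrec (fun x : seq nat * (nat * nat) => guess_code eH eK x.1 x.2.1 x.2.2).
Proof.
rewrite /guess_code /killed_code.
by repeat match goal with
  | |- primrec (fun _ => words _) => apply: primrec_words
  | |- primrec (fun _ => accepts _ _ _) => apply: primrec_accepts
  | |- primrec (fun _ => simulated _ _ _) => apply: primrec_simulated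
  | |- primrec (fun _ => pair_prefix _ _ _) => apply: primrec_pair_prefix
  | |- _ => primrec_step
  end.
Qed.

(** * Weakly computable functions *)

Definition point (z : nat -> nat) : cantor_space := fun n => z n == 1.

(** The reduction must work with every realizer of closed choice. One that
    returns a prescribed point of the set shows that MK succeeds on every point,
    and one that is undefined on the given name would be admissible if the set
    were empty, so that it is not. *)
Lemma weakly_computable_machines (X Y : represented_space) (f : X -> set Y) :
  weakly_computable f -> exists MH MK : program,
    [/\ ~~ has is_erase MH, ~~ has is_erase MK &
    forall p x, rep X p = Some x -> mdom f x -> exists2 h,
      writes MH p h & (exists2 z, binary z & negative_set h (point z)) /\
      forall z, binary z -> negative_set h (point z) ->
        exists q y, [/\ writes MK (baire_pair p z) q, rep Y q = Some y & f x y]].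
Proof.
move=> [K [H [[MK noK cK] [MH noH cH] red]]]; exists MH, MK; split=> // p x px fx.
have binP z : binary z -> cantor_rep z = Some (point z).
  by move=> bz; rewrite /cantor_rep asboolT.
have [g gP] : exists g : baire -> baire, forall h, negative_set h !=set0 ->
    binary (g h) /\ negative_set h (point (g h)).
  suff /choice[g gP] : forall h : baire, exists z : baire, negative_set h !=set0 ->
      binary z /\ negative_set h (point z) by exists g.
  move=> h; have [[y hy]|e] := pselect (negative_set h !=set0); last by exists h.
  exists (fun n => nat_of_bool (y n)) => _; split=> [n|]; first by case: (y n).
  by rewrite (_ : point _ = y) //; apply: funext => n; rewrite /point; case: (y n).
have real (G : baire -> option baire) : (forall h, negative_set h !=set0 ->
    exists z, [/\ G h = Some z, binary z & negative_set h (point z)]) ->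
    realizes (X := closed_repspace) (Y := cantor_repspace) G closed_choice.
  move=> hG h _ [<-] [y Ay]; have [|z [Gz bz zh]] := hG h; first by exists y.
  by exists z, (point z); split=> //=; exact: binP.
have [h Hp] : exists h, H p = Some h.
  have := red (fun h => Some (g h)) (real _ _) p x px fx.
  case: (H p) => [h _|[]]; first by exists h.
    by move=> h /gP[]; exists (g h).
  by move=> q [y []].
have hne : negative_set h !=set0.
  apply: contrapT => e; pose G h' := if `[< h' = h >] then None else Some (g h').
  have rG : realizes (X := closed_repspace) (Y := cantor_repspace) G closed_choice.
    apply: real => h' h'ne; exists (g h'); have [] := gP h' h'ne; split=> //.
    by rewrite /G asboolF // => hh; apply: e; rewrite -hh.
  have [q [y []]] := red G rG p x px fx.
  by rewrite Hp /= /G asboolT.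
exists h; first exact: cH.
split=> [|z bz zh]; first by have [] := gP h hne; exists (g h).
pose G h' : option baire := if `[< h' = h >] then Some z else Some (g h').
have rG : realizes (X := closed_repspace) (Y := cantor_repspace) G closed_choice.
  apply: real => h' h'ne; rewrite /G; case: asboolP => [->|_]; first by exists z.
  by have [] := gP h' h'ne; exists (g h').
have [q [y []]] := red G rG p x px fx.
rewrite Hp /= /G asboolT //= => /cK wq qy fxy.
by exists q, y.
Qed.

Lemma removedP MH p h z : ~~ has is_erase MH -> writes MH p h -> binary z ->
  negative_set h (point z) <-> forall s, ~~ removed MH p s z.
Proof.
move=> noH /writes_result[t0 [sub sup]] bz.
have ptE l : map nat_of_bool (mkseq (point z) l) = mkseq z l.
  rewrite /mkseq -map_comp; apply/eq_in_map => i _ /=.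
  by rewrite /point; have := bz i; case: (z i) => [|[|]].
split=> [zh s|zh [w [i hi] wz]].
  apply/negP => /hasP[c cR /hasP[l _ /eqP cE]]; apply: zh.
  have [n /prefixP[r e]] := sub _ (leq_maxl t0 s).
  have /prefixP[r' e'] := result_mono p noH (leq_maxr t0 s).
  have : c \in mkseq h n by rewrite e e' !mem_cat cR.
  move=> /mapP[i _ hi]; exists (mkseq (point z) l); last by rewrite cylinder_mkseq.
  by exists i; rewrite ptE -cE.
have [t1 /(_ (maxn t1 (size w)) (leq_maxl _ _)) /prefixP[r e]] := sup i.+1.
have /negP := zh (maxn t1 (size w)); apply; apply/hasP; exists (h i).
  by rewrite e mem_cat map_f // mem_iota ltnSn.
apply/hasP; exists (size w).
  by apply/mapP; exists (size w); rewrite // mem_iota /= ltnS leq_maxr.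
by rewrite hi -ptE wz.
Qed.

Lemma weakly_computable_low (X Y : represented_space) (f : X -> set Y) :
  weakly_computable f -> low_computable f.
Proof.
move=> /weakly_computable_machines[MH [MK [noH noK hf]]].
have [eH eHE] := decode_program_surj MH; have [eK eKE] := decode_program_surj MK.
apply: (low_computable_stages
  (b := fun w s n => nth false (guess_code eH eK w s n.+1) n)).
  primrec_tac.
  apply: (primrec_comp (g := fun x : seq nat * (nat * nat) => (x.1, (x.2.1, x.2.2.+1)))
    (primrec_guess_code eH eK)).
  by primrec_tac.
move=> p x px fx; have [h wh [[z0 bz0 z0h] hK]] := hf p x px fx.
have [|z [bz zr zd]] := low_point noH noK (p := p) (MH := MH) (MK := MK).
  by exists z0 => //; apply/(removedP noH wh bz0).
have zh : negative_set h (point z) by apply/(removedP noH wh bz).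
have [q [y [wq qy fxy]]] := hK z bz zh.
exists q, y; split=> // n; have [s0 gd] := guess_decisions p noH noK n.+1.
have [t0 aq] := writes_accepts n wq.
exists s0 => s k s0s sk; rewrite guess_codeE // eHE eKE gd //.
have -> : nth false (decisions MH MK p n.+1) n = accepts n t0 (result MK (baire_pair p z) t0).
  apply/idP/idP => [/zd[s1 e1]|a]; last by apply/zd; exists t0.
  have := aq _ (leq_maxl t0 s1); rewrite -(aq _ (leqnn t0)).
  rewrite (accepts_mono (leq_maxr t0 s1) _ e1); last exact: result_mono (leq_maxr _ _).
  by case: accepts.
exact: aq.
Qed.

Theorem corollary8p14 (X Y : represented_space) (f : X -> set Y) :
  mind_change_computable f \/ weakly_computable f -> low_computable f.
Proof.
by move=> [/mind_change_low|/weakly_computable_low].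
Qed.
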